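(* Let $D\subset\mathbb{R}^2$ be a connected and simply connected domain with non-empty interior, bounded by a smooth closed curve $\gamma$. Let $F=(f,g):D\to D$ be a moderate symplectomorphism (so $f_xg_y-f_yg_x=1$) which is the identity on $\gamma$, and assume that $F$ has no conformal points on $\gamma$. Then $F$ possesses at least two conformal points in the interior of $D$, counted with multiplicity.
   Context: A symplectomorphism of $D$ is an area- and orientation-preserving diffeomorphism $D\to D$. $F$ is called moderate if its graph $G=\{(z,F(z))\}\subset\mathbb{C}^2$ is everywhere transverse to the fibers of the projection $\mathrm{pr}(z_1,z_2)=\big(\tfrac{z_1+z_2}{2},\tfrac{z_1+z_2}{2}\big)$, i.e. the tangent plane of $G$ at each point is complementary to the kernel of $d\,\mathrm{pr}$; equivalently $2+f_x+g_y\neq 0$ on $D$. A point is a conformal point of $F$ if $dF$ is a similarity there, i.e. $f_x=g_y$ and $f_y=-g_x$. Conformal points are the zeros of the vector field with components $(f_x-g_y,\ f_y+g_x)$ (expressed in the coordinates $w=\tfrac{z+F(z)}{2}$), and ''counted with multiplicity'' refers to the indices of these zeros, whose sum is asserted to be at least $2$. *)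

(* Defs.v *)
From Stdlib Require Import Reals Lra List ZArith.
From Coquelicot Require Import Coquelicot.
Open Scope R_scope.

Definition pt := (R * R)%type.

Definition dist2 (p q : pt) : R :=
  Rmax (Rabs (fst p - fst q)) (Rabs (snd p - snd q)).

Definition cont2 (h : R -> R -> R) (p : pt) : Prop :=
  forall eps, 0 < eps -> exists delta, 0 < delta /\
    forall q : pt, dist2 q p < delta ->
      Rabs (h (fst q) (snd q) - h (fst p) (snd p)) < eps.

Definition dx (h : R -> R -> R) : R -> R -> R :=
  fun x y => Derive (fun t => h t y) x.
Definition dy (h : R -> R -> R) : R -> R -> R :=
  fun x y => Derive (fun t => h x t) y.

Fixpoint pder (l : list bool) (h : R -> R -> R) : R -> R -> R :=
  match l with
  | nil => h
  | b :: l' => (if b then dx else dy) (pder l' h)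
  end.

Definition smooth2 (h : R -> R -> R) : Prop :=
  forall (l : list bool) (x y : R),
    ex_derive (fun t => pder l h t y) x /\
    ex_derive (fun t => pder l h x t) y /\
    cont2 (pder l h) (x, y).

Definition smooth1 (u : R -> R) : Prop := forall (n : nat) (t : R), ex_derive_n u n t.

Definition smooth_simple_closed_curve (gam : R -> pt) : Prop :=
  smooth1 (fun t => fst (gam t)) /\ smooth1 (fun t => snd (gam t)) /\
  (forall t, gam (t + 1) = gam t) /\
  (forall s t, 0 <= s < 1 -> 0 <= t < 1 -> gam s = gam t -> s = t) /\
  (forall t, Derive (fun s => fst (gam s)) t <> 0 \/ Derive (fun s => snd (gam s)) t <> 0).

Definition interior2 (D : pt -> Prop) (p : pt) : Prop :=
  exists eps, 0 < eps /\ forall q, dist2 q p < eps -> D q.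
Definition closure2 (D : pt -> Prop) (p : pt) : Prop :=
  forall eps, 0 < eps -> exists q, D q /\ dist2 q p < eps.
Definition boundary2 (D : pt -> Prop) (p : pt) : Prop :=
  closure2 D p /\ ~ interior2 D p.
Definition closed2 (D : pt -> Prop) : Prop := forall p, closure2 D p -> D p.
Definition bounded2 (D : pt -> Prop) : Prop :=
  exists M, forall p, D p -> Rabs (fst p) <= M /\ Rabs (snd p) <= M.
Definition open2 (U : pt -> Prop) : Prop := forall p, U p -> interior2 U p.

Definition connected2 (D : pt -> Prop) : Prop :=
  ~ exists U V : pt -> Prop, open2 U /\ open2 V /\
      (forall p, D p -> U p \/ V p) /\
      (exists p, D p /\ U p) /\ (exists p, D p /\ V p) /\
      (forall p, D p -> U p -> V p -> False).

Definition cont_on_RR (A : R -> Prop) (h : R -> R) : Prop :=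
  forall s, A s -> forall eps, 0 < eps -> exists delta, 0 < delta /\
    forall t, A t -> Rabs (t - s) < delta -> Rabs (h t - h s) < eps.
Definition cont_on_Rpt (A : R -> Prop) (h : R -> pt) : Prop :=
  forall s, A s -> forall eps, 0 < eps -> exists delta, 0 < delta /\
    forall t, A t -> Rabs (t - s) < delta -> dist2 (h t) (h s) < eps.
Definition cont_on_ptpt (A : pt -> Prop) (h : pt -> pt) : Prop :=
  forall p, A p -> forall eps, 0 < eps -> exists delta, 0 < delta /\
    forall q, A q -> dist2 q p < delta -> dist2 (h q) (h p) < eps.

Definition I01 (t : R) : Prop := 0 <= t <= 1.
Definition sq01 (p : pt) : Prop := I01 (fst p) /\ I01 (snd p).

Definition simply_connected2 (D : pt -> Prop) : Prop :=
  (forall p q, D p -> D q -> exists c : R -> pt,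
      cont_on_Rpt I01 c /\ (forall t, I01 t -> D (c t)) /\ c 0 = p /\ c 1 = q) /\
  (forall c : R -> pt, cont_on_Rpt I01 c -> (forall t, I01 t -> D (c t)) -> c 0 = c 1 ->
     exists H : pt -> pt, cont_on_ptpt sq01 H /\
       (forall p, sq01 p -> D (H p)) /\
       (forall t, I01 t -> H (0, t) = c t) /\
       (forall t, I01 t -> H (1, t) = c 0) /\
       (forall s, I01 s -> H (s, 0) = H (s, 1))).

Definition winding (c : R -> pt) (k : Z) : Prop :=
  c 0 = c 1 /\ (forall t, I01 t -> c t <> (0, 0)) /\
  exists theta : R -> R, cont_on_RR I01 theta /\
    (forall t, I01 t ->
       let r := sqrt (fst (c t) ^ 2 + snd (c t) ^ 2) in
       c t = (r * cos (theta t), r * sin (theta t))) /\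
    theta 1 - theta 0 = 2 * PI * IZR k.

Definition jac (f g : R -> R -> R) (p : pt) : R :=
  dx f (fst p) (snd p) * dy g (fst p) (snd p) - dy f (fst p) (snd p) * dx g (fst p) (snd p).

Definition moderate_at (f g : R -> R -> R) (p : pt) : Prop :=
  2 + dx f (fst p) (snd p) + dy g (fst p) (snd p) <> 0.

Definition conformal_point (f g : R -> R -> R) (p : pt) : Prop :=
  dx f (fst p) (snd p) = dy g (fst p) (snd p) /\
  dy f (fst p) (snd p) = - dx g (fst p) (snd p).

Definition appF (f g : R -> R -> R) (p : pt) : pt := (f (fst p) (snd p), g (fst p) (snd p)).

Definition wcoord (f g : R -> R -> R) (p : pt) : pt :=
  ((fst p + f (fst p) (snd p)) / 2, (snd p + g (fst p) (snd p)) / 2).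

Definition confV (f g : R -> R -> R) (p : pt) : pt :=
  (dx f (fst p) (snd p) - dy g (fst p) (snd p),
   dy f (fst p) (snd p) + dx g (fst p) (snd p)).

Definition w_circle_lift (f g : R -> R -> R) (z0 : pt) (r0 r : R) (z : R -> pt) : Prop :=
  cont_on_Rpt I01 z /\ z 0 = z 1 /\
  forall t, I01 t -> dist2 (z t) z0 < r0 /\
    wcoord f g (z t) = (fst (wcoord f g z0) + r * cos (2 * PI * t),
                        snd (wcoord f g z0) + r * sin (2 * PI * t)).

(* index k of the zero z0 of the vector field (f_x - g_y, f_y + g_x) expressed in
   the w-coordinates: winding number of the field along small circles around w(z0)
   in the w-plane *)
Definition conf_index (f g : R -> R -> R) (z0 : pt) (k : Z) : Prop :=
  exists r0 rho, 0 < r0 /\ 0 < rho /\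
    forall r, 0 < r < rho ->
      (exists z, w_circle_lift f g z0 r0 r z) /\
      (forall z, w_circle_lift f g z0 r0 r z -> winding (fun t => confV f g (z t)) k).

Fixpoint sumZ (l : list Z) : Z := match l with nil => 0%Z | k :: l' => (k + sumZ l')%Z end.

(* Main.v *)
(* Along gamma the map F fixes the tangent vector and has determinant 1, so dF is a shear and the field
   V = (f_x - g_y, f_y + g_x), read as a complex number, is i times a real nonzero multiple of the square
   of the tangent; hence V winds twice as often along gamma as the tangent does.  Let e be the winding
   number of the tangent.  It equals that of gamma about every interior point of D, and e is nonzero.
   After multiplication by powers of (z - p) or its conjugate, V can be redefined near each of its zeros p
   without vanishing, and what remains has winding number 0 along gamma because D is simply connected;
   so the winding number of V along gamma is e times the sum of the indices.  Therefore the sum is 2.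
   The passage to w-coordinates costs nothing: at a conformal point dF is complex linear, so w is
   to first order a multiplication by a complex number, nonzero because F is moderate. *)

Require Import Defs.
From Stdlib Require Import Reals Lra Lia List ZArith ClassicalEpsilon.
From Coquelicot Require Import Coquelicot.
Open Scope R_scope.

(** * Continuity of complex-valued functions *)

(** The orientation of gamma is never determined. Its winding number about interior points and that
    of its tangent are shown to be the same integer e, which enters both computations of the winding
    of V as a factor and cancels, so it is enough that e is nonzero. No form of the Jordan curve
    theorem is assumed. Its place is taken by a thin normal collar of gamma: each point off the
    curve can be joined to one of the two sides of the collar without meeting the curve, and along
    such a path neither membership in D nor the winding number of gamma about the moving point
    changes. Simple connectedness enters through a single consequence: a continuous field without
    zeros on D has winding number 0 along every loop in D. Applied to z - q with q outside D, it
    gives winding number 0 about the outer side of the collar. *)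

Definition ccont {U : UniformSpace} (h : U -> C) (x : U) : Prop :=
  continuous (fun u => Re (h u)) x /\ continuous (fun u => Im (h u)) x.

Lemma rcont_plus {U : UniformSpace} (f g : U -> R) (x : U) :
  continuous f x -> continuous g x -> continuous (fun u => f u + g u) x.
Proof. intros Hf Hg. exact (continuous_plus f g x Hf Hg). Qed.

Lemma rcont_opp {U : UniformSpace} (f : U -> R) (x : U) :
  continuous f x -> continuous (fun u => - f u) x.
Proof. intros Hf. exact (continuous_opp f x Hf). Qed.

Lemma rcont_minus {U : UniformSpace} (f g : U -> R) (x : U) :
  continuous f x -> continuous g x -> continuous (fun u => f u - g u) x.
Proof. intros Hf Hg. exact (continuous_minus f g x Hf Hg). Qed.

Lemma rcont_mult {U : UniformSpace} (f g : U -> R) (x : U) :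
  continuous f x -> continuous g x -> continuous (fun u => f u * g u) x.
Proof. intros Hf Hg. exact (continuous_mult f g x Hf Hg). Qed.

Lemma rcont_const {U : UniformSpace} (c : R) (x : U) : continuous (fun _ : U => c) x.
Proof. exact (continuous_const c x). Qed.

Lemma rcont_comp {U : UniformSpace} (f : U -> R) (g : R -> R) (x : U) :
  continuous f x -> continuity_pt g (f x) -> continuous (fun u => g (f u)) x.
Proof.
  intros Hf Hg. apply continuous_comp; [exact Hf|].
  apply continuity_pt_filterlim. exact Hg.
Qed.

Lemma rcont_inv {U : UniformSpace} (f : U -> R) (x : U) :
  continuous f x -> f x <> 0 -> continuous (fun u => / f u) x.
Proof.
  intros Hf H0. apply (rcont_comp f Rinv); [exact Hf|].
  apply (continuity_pt_inv id); [apply derivable_continuous_pt, derivable_pt_id|exact H0].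
Qed.

Lemma rcont_div {U : UniformSpace} (f g : U -> R) (x : U) :
  continuous f x -> continuous g x -> g x <> 0 -> continuous (fun u => f u / g u) x.
Proof. intros. apply rcont_mult; [assumption|now apply rcont_inv]. Qed.

Lemma rcont_max {U : UniformSpace} (f g : U -> R) (x : U) :
  continuous f x -> continuous g x -> continuous (fun u => Rmax (f u) (g u)) x.
Proof.
  intros Hf Hg.
  apply continuous_ext with (fun u => (f u + g u + Rabs (f u - g u)) * / 2).
  - intros u. unfold Rmax, Rabs. destruct (Rle_dec (f u) (g u)), (Rcase_abs (f u - g u)); lra.
  - apply rcont_mult; [|apply rcont_const].
    apply rcont_plus; [now apply rcont_plus|].
    apply (rcont_comp (fun u => f u - g u) Rabs); [now apply rcont_minus|].
    apply Rcontinuity_abs.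
Qed.

Lemma rcont_min {U : UniformSpace} (f g : U -> R) (x : U) :
  continuous f x -> continuous g x -> continuous (fun u => Rmin (f u) (g u)) x.
Proof.
  intros Hf Hg.
  apply continuous_ext with (fun u => - Rmax (- f u) (- g u)).
  - intros u. unfold Rmax, Rmin. destruct (Rle_dec (f u) (g u)), (Rle_dec (- f u) (- g u)); lra.
  - apply rcont_opp, rcont_max; now apply rcont_opp.
Qed.

Lemma rcont_2 {U : UniformSpace} (a b : U -> R) (phi : C -> R) (x : U) :
  continuous a x -> continuous b x ->
  continuous phi (a x, b x) -> continuous (fun u => phi (a u, b u)) x.
Proof.
  intros Ha Hb Hp.
  apply (continuous_comp_2 a b (fun p q => phi (p, q)) x Ha Hb).
  apply continuous_ext with phi; [now intros [p q]|exact Hp].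
Qed.

Lemma ccont_comp {U : UniformSpace} (h : U -> C) (V : C -> C) (x : U) :
  ccont h x -> ccont V (h x) -> ccont (fun u => V (h u)) x.
Proof.
  intros [H1 H2] [V1 V2].
  assert (E : forall u, h u = (Re (h u), Im (h u))) by (intros u; now destruct (h u)).
  split.
  - apply continuous_ext with (fun u => Re (V (Re (h u), Im (h u)))).
    + intros u. now rewrite <- E.
    + apply (rcont_2 _ _ (fun z => Re (V z))); auto. now rewrite <- E.
  - apply continuous_ext with (fun u => Im (V (Re (h u), Im (h u)))).
    + intros u. now rewrite <- E.
    + apply (rcont_2 _ _ (fun z => Im (V z))); auto. now rewrite <- E.
Qed.

Lemma rcont_ccomp {U : UniformSpace} (h : U -> C) (phi : C -> R) (x : U) :
  ccont h x -> continuous phi (h x) -> continuous (fun u => phi (h u)) x.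
Proof.
  intros [H1 H2] Hp.
  assert (E : forall u, h u = (Re (h u), Im (h u))) by (intros u; now destruct (h u)).
  apply continuous_ext with (fun u => phi (Re (h u), Im (h u))).
  - intros u. now rewrite <- E.
  - apply (rcont_2 _ _ phi); auto. now rewrite <- E.
Qed.

Lemma ccont_Rcomp {U : UniformSpace} (f : U -> R) (c : R -> C) (x : U) :
  continuous f x -> ccont c (f x) -> ccont (fun u => c (f u)) x.
Proof. intros Hf [H1 H2]. split;
    [apply (continuous_comp f (fun t => Re (c t)))|apply (continuous_comp f (fun t => Im (c t)))];
    assumption. Qed.

Lemma ccont_pair {U : UniformSpace} (a b : U -> R) (x : U) :
  continuous a x -> continuous b x -> ccont (fun u => (a u, b u)) x.
Proof. now split. Qed.

Lemma ccont_const {U : UniformSpace} (c : C) (x : U) : ccont (fun _ : U => c) x.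
Proof. split; apply rcont_const. Qed.

Lemma ccont_id (z : C) : ccont (fun z : C => z) z.
Proof. destruct z; split; [apply continuous_fst|apply continuous_snd]. Qed.

Lemma ccont_RtoC {U : UniformSpace} (f : U -> R) (x : U) :
  continuous f x -> ccont (fun u => RtoC (f u)) x.
Proof. intros; split; [assumption|apply rcont_const]. Qed.

Lemma ccont_plus {U : UniformSpace} (f g : U -> C) (x : U) :
  ccont f x -> ccont g x -> ccont (fun u => (f u + g u)%C) x.
Proof. intros [] []; split; now apply rcont_plus. Qed.

Lemma ccont_opp {U : UniformSpace} (f : U -> C) (x : U) :
  ccont f x -> ccont (fun u => (- f u)%C) x.
Proof. intros []; split; now apply rcont_opp. Qed.

Lemma ccont_minus {U : UniformSpace} (f g : U -> C) (x : U) :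
  ccont f x -> ccont g x -> ccont (fun u => (f u - g u)%C) x.
Proof. intros; apply ccont_plus; [assumption|now apply ccont_opp]. Qed.

Lemma ccont_conj {U : UniformSpace} (f : U -> C) (x : U) :
  ccont f x -> ccont (fun u => Cconj (f u)) x.
Proof. intros []; split; [assumption|now apply rcont_opp]. Qed.

Lemma ccont_mult {U : UniformSpace} (f g : U -> C) (x : U) :
  ccont f x -> ccont g x -> ccont (fun u => (f u * g u)%C) x.
Proof.
  intros [] []; split; [apply rcont_minus|apply rcont_plus]; now apply rcont_mult.
Qed.

Lemma ccont_pow {U : UniformSpace} (f : U -> C) (n : nat) (x : U) :
  ccont f x -> ccont (fun u => (f u ^ n)%C) x.
Proof.
  intros Hf. induction n as [|n IH]; simpl; [apply ccont_const|now apply ccont_mult].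
Qed.

Lemma rcont_Cmod {U : UniformSpace} (f : U -> C) (x : U) :
  ccont f x -> continuous (fun u => Cmod (f u)) x.
Proof.
  intros [H1 H2]. unfold Cmod.
  apply (rcont_comp (fun u => fst (f u) ^ 2 + snd (f u) ^ 2) sqrt).
  - apply rcont_plus; simpl; (apply rcont_mult; [assumption|]);
      (apply rcont_mult; [assumption|apply rcont_const]).
  - apply continuity_pt_sqrt. nra.
Qed.

(** * Angles *)

Definition cis (x : R) : C := (cos x, sin x).

Lemma ccont_cis {U : UniformSpace} (f : U -> R) (x : U) :
  continuous f x -> ccont (fun u => cis (f u)) x.
Proof.
  intros Hf; split; apply (rcont_comp f); try assumption;
    [apply continuity_cos|apply continuity_sin].
Qed.

Lemma rcont_id (x : R) : continuous (fun t : R => t) x.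
Proof. apply continuous_id. Qed.

Lemma rcont_fst (z : C) : continuous (fun z : C => fst z) z.
Proof. apply ccont_id. Qed.

Lemma rcont_snd (z : C) : continuous (fun z : C => snd z) z.
Proof. apply ccont_id. Qed.

Ltac cont := repeat first
  [ assumption
  | lazymatch goal with
    | |- continuous (fun u => u) _ => apply rcont_id
    | |- continuous (fun u => fst u) _ => apply rcont_fst
    | |- continuous (fun u => snd u) _ => apply rcont_snd
    | |- continuous fst _ => apply rcont_fst
    | |- continuous snd _ => apply rcont_snd
    | |- continuous (fun u => @?f u + @?g u) _ => apply (rcont_plus f g)
    | |- continuous (fun u => @?f u - @?g u) _ => apply (rcont_minus f g)
    | |- continuous (fun u => @?f u * @?g u) _ => apply (rcont_mult f g)
    | |- continuous (fun u => - @?f u) _ => apply (rcont_opp f)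
    | |- continuous (fun u => Rmax (@?f u) (@?g u)) _ => apply (rcont_max f g)
    | |- continuous (fun u => Rmin (@?f u) (@?g u)) _ => apply (rcont_min f g)
    | |- continuous (fun u => Cmod (@?f u)) _ => apply (rcont_Cmod f)
    | |- continuous (fun u => ?c) _ => apply rcont_const
    | |- ccont (fun u => u) _ => apply ccont_id
    | |- ccont (fun u => (@?f u + @?g u)%C) _ => apply (ccont_plus f g)
    | |- ccont (fun u => (@?f u - @?g u)%C) _ => apply (ccont_minus f g)
    | |- ccont (fun u => (@?f u * @?g u)%C) _ => apply (ccont_mult f g)
    | |- ccont (fun u => (- @?f u)%C) _ => apply (ccont_opp f)
    | |- ccont (fun u => (@?f u ^ _)%C) _ => apply (ccont_pow f)
    | |- ccont (fun u => RtoC (@?f u)) _ => apply (ccont_RtoC f)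
    | |- ccont (fun u => Cconj (@?f u)) _ => apply (ccont_conj f)
    | |- ccont (fun u => cis (@?f u)) _ => apply (ccont_cis f)
    | |- ccont (fun u => ?c) _ => apply ccont_const
    end ].

(** * Epsilon-delta forms of continuity, and the retraction of the line onto [0, 1] *)

Lemma rcont_eps (f : R -> R) (x : R) :
  continuous f x <-> forall eps, 0 < eps -> exists delta, 0 < delta /\
    forall y, Rabs (y - x) < delta -> Rabs (f y - f x) < eps.
Proof.
  split.
  - intros H eps He. apply filterlim_locally with (eps := mkposreal eps He) in H.
    destruct H as [d Hd]. exists d; split; [apply cond_pos|]. intros y Hy. now apply Hd.
  - intros H. apply filterlim_locally. intros [eps He]. destruct (H eps He) as [d [d0 Hd]].
    exists (mkposreal d d0). intros y Hy. now apply Hd.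
Qed.

Lemma rcont2_eps (f : C -> R) (p : C) :
  continuous f p <-> forall eps, 0 < eps -> exists delta, 0 < delta /\
    forall q, Rabs (fst q - fst p) < delta -> Rabs (snd q - snd p) < delta ->
      Rabs (f q - f p) < eps.
Proof.
  split.
  - intros H eps He. apply filterlim_locally with (eps := mkposreal eps He) in H.
    destruct H as [d Hd]. exists d; split; [apply cond_pos|]. intros y Hy1 Hy2.
    apply Hd. now split.
  - intros H. apply filterlim_locally. intros [eps He]. destruct (H eps He) as [d [d0 Hd]].
    exists (mkposreal d d0). intros y [Hy1 Hy2]. now apply Hd.
Qed.

Lemma dist2_lt (p q : pt) (e : R) :
  dist2 p q < e <-> Rabs (fst p - fst q) < e /\ Rabs (snd p - snd q) < e.
Proof.
  unfold dist2. split.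
  - intros H; split; eapply Rle_lt_trans; try exact H; [apply Rmax_l|apply Rmax_r].
  - intros [H1 H2]. now apply Rmax_lub_lt.
Qed.

Lemma dist2_Cmod (p q : pt) : dist2 p q <= Cmod (p - q)%C.
Proof. apply (Rmax_Cmod (p - q)%C). Qed.

Lemma Cmod_dist2 (p q : pt) : Cmod (p - q)%C <= 2 * dist2 p q.
Proof.
  eapply Rle_trans; [apply Cmod_2Rmax|].
  apply Rmult_le_compat_r.
  - apply Rle_trans with (Rabs (fst (p - q)%C)); [apply Rabs_pos|apply Rmax_l].
  - rewrite <- (sqrt_Rsqr 2) at 2 by lra. apply sqrt_le_1_alt. unfold Rsqr; lra.
Qed.

Lemma ccont_eps (c : R -> C) (x : R) :
  ccont c x <-> forall eps, 0 < eps -> exists delta, 0 < delta /\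
    forall y, Rabs (y - x) < delta -> dist2 (c y) (c x) < eps.
Proof.
  split.
  - intros [H1 H2] eps He.
    destruct (proj1 (rcont_eps _ _) H1 eps He) as [d1 [p1 K1]].
    destruct (proj1 (rcont_eps _ _) H2 eps He) as [d2 [p2 K2]].
    exists (Rmin d1 d2). split; [now apply Rmin_pos|]. intros y Hy. apply dist2_lt.
    split; [apply K1|apply K2]; eapply Rlt_le_trans; try exact Hy; [apply Rmin_l|apply Rmin_r].
  - intros H. split; apply rcont_eps; intros eps He; destruct (H eps He) as [d [d0 Hd]];
      exists d; (split; [exact d0|]); intros y Hy; apply Hd, dist2_lt in Hy; apply Hy.
Qed.

Lemma ccont2_eps (h : C -> C) (p : C) :
  ccont h p <-> forall eps, 0 < eps -> exists delta, 0 < delta /\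
    forall q, dist2 q p < delta -> dist2 (h q) (h p) < eps.
Proof.
  split.
  - intros [H1 H2] eps He.
    destruct (proj1 (rcont2_eps _ _) H1 eps He) as [d1 [p1 K1]].
    destruct (proj1 (rcont2_eps _ _) H2 eps He) as [d2 [p2 K2]].
    exists (Rmin d1 d2). split; [now apply Rmin_pos|]. intros q Hq. apply dist2_lt in Hq.
    destruct Hq as [Hq1 Hq2]. pose proof (Rmin_l d1 d2). pose proof (Rmin_r d1 d2).
    apply dist2_lt. split; [apply K1|apply K2]; lra.
  - intros H. split; apply rcont2_eps; intros eps He; destruct (H eps He) as [d [d0 Hd]];
      exists d; (split; [exact d0|]); intros q Hq1 Hq2;
      assert (K : dist2 q p < d) by (now apply dist2_lt);
      apply Hd, dist2_lt in K; apply K.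
Qed.

Lemma ccont_ext_loc (h k : C -> C) (p : C) (d : R) : 0 < d ->
  (forall q, dist2 q p < d -> h q = k q) -> ccont h p -> ccont k p.
Proof.
  intros d0 E H. apply ccont2_eps. intros eps He.
  destruct (proj1 (ccont2_eps _ _) H eps He) as [d' [d0' Hd]].
  exists (Rmin d d'). split; [now apply Rmin_pos|].
  intros q Hq. rewrite <- !E.
  - apply Hd. eapply Rlt_le_trans; [exact Hq|apply Rmin_r].
  - apply dist2_lt. replace (fst p - fst p) with 0 by ring. replace (snd p - snd p) with 0 by ring.
    rewrite Rabs_R0. auto.
  - eapply Rlt_le_trans; [exact Hq|apply Rmin_l].
Qed.

(** Precomposition with this retraction turns data controlled only on [0, 1] into functions
    continuous on the whole line, so that two-sided continuity can be used at the end points as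
    well. *)
Definition clamp (t : R) : R := Rmax 0 (Rmin 1 t).

Lemma clamp_I (t : R) : 0 <= clamp t <= 1.
Proof.
  unfold clamp. split; [apply Rmax_l|]. apply Rmax_lub; [lra|apply Rmin_l].
Qed.

Lemma clamp_id (t : R) : 0 <= t <= 1 -> clamp t = t.
Proof. intros H. unfold clamp. rewrite Rmin_right by lra. now apply Rmax_right. Qed.

Lemma rcont_clamp {U : UniformSpace} (f : U -> R) (x : U) :
  continuous f x -> continuous (fun u => clamp (f u)) x.
Proof. intros. unfold clamp. cont. Qed.

(** * Polar form of complex numbers *)

Lemma cis_plus (x y : R) : cis (x + y) = (cis x * cis y)%C.
Proof.
  unfold cis. rewrite cos_plus, sin_plus. unfold Cmult; simpl. f_equal; ring.
Qed.

Lemma cis_opp (x : R) : cis (- x) = Cconj (cis x).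
Proof. unfold cis, Cconj; simpl. now rewrite cos_neg, sin_neg. Qed.

Lemma cis_0 : cis 0 = 1%C.
Proof. unfold cis. now rewrite cos_0, sin_0. Qed.

Lemma Cmod_cis (x : R) : Cmod (cis x) = 1.
Proof.
  unfold Cmod, cis; simpl. replace (_ + _) with (Rsqr (sin x) + Rsqr (cos x)).
  - rewrite sin2_cos2. apply sqrt_1.
  - unfold Rsqr. ring.
Qed.

Lemma cis_eq_1 (x : R) : cis x = 1%C -> exists k : Z, x = 2 * PI * IZR k.
Proof.
  intros H. injection H as H1 H2.
  assert (S : sin (x / 2) = 0).
  { replace x with (2 * (x / 2)) in H1 by field. rewrite cos_2a_sin in H1. nra. }
  destruct (sin_eq_0_0 _ S) as [k Hk]. exists k. lra.
Qed.

Lemma cis_2PI_Z (k : Z) : cis (2 * PI * IZR k) = 1%C.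
Proof.
  assert (S : sin (PI * IZR k) = 0) by (apply sin_eq_0_1; exists k; ring).
  unfold cis. replace (2 * PI * IZR k) with (2 * (PI * IZR k)) by ring.
  rewrite cos_2a_sin, sin_2a, S. unfold RtoC. f_equal; ring.
Qed.

Lemma cis_1 : cis (2 * PI) = 1%C.
Proof. rewrite <- (cis_2PI_Z 1). f_equal. ring. Qed.

Lemma cis_eq (x y : R) : cis x = cis y -> exists k : Z, x - y = 2 * PI * IZR k.
Proof.
  intros H. apply cis_eq_1. unfold Rminus. rewrite cis_plus, cis_opp, H.
  rewrite <- Cmod2_conj, Cmod_cis. unfold RtoC. f_equal. ring.
Qed.

(** The principal argument, but only in the right half-plane. Elsewhere it is merely a function of
    the ratio Im / Re, which still makes it invariant under positive factors. *)
Definition carg (q : C) : R := atan (Im q / Re q).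

Lemma carg_spec (q : C) : 0 < Re q -> q = (Cmod q * cis (carg q))%C.
Proof.
  destruct q as [x y]; simpl; intros Hx.
  unfold carg, cis; simpl. rewrite cos_atan, sin_atan.
  assert (E : Cmod (x, y) = x * sqrt (1 + (y / x)²)).
  { unfold Cmod; simpl. rewrite <- (sqrt_Rsqr x) at 3 by lra.
    rewrite <- sqrt_mult; [|apply Rle_0_sqr|pose proof (Rle_0_sqr (y / x)); lra].
    f_equal. unfold Rsqr. field. lra. }
  rewrite E. assert (0 < sqrt (1 + (y / x)²)).
  { apply sqrt_lt_R0. pose proof (Rle_0_sqr (y / x)). lra. }
  unfold Cmult, RtoC; simpl. f_equal; field; lra.
Qed.

Lemma carg_scale (r : R) (q : C) : 0 < r -> carg (r * q)%C = carg q.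
Proof.
  intros Hr. unfold carg. f_equal. destruct q as [x y]; simpl.
  (* On the imaginary axis both ratios are 0 by the convention for division by 0. *)
  destruct (Req_dec x 0) as [->|Hx].
  - unfold Rdiv. replace (r * 0 - 0 * y) with 0 by ring. rewrite Rinv_0. ring.
  - field. lra.
Qed.

Lemma rcont_carg {U : UniformSpace} (f : U -> C) (x : U) :
  ccont f x -> Re (f x) <> 0 -> continuous (fun u => carg (f u)) x.
Proof.
  intros [H1 H2] H0. unfold carg. apply (rcont_comp (fun u => Im (f u) / Re (f u)) atan).
  - now apply rcont_div.
  - apply derivable_continuous_pt, derivable_pt_atan.
Qed.

(** A rotation by PI or by a right angle brings a nonzero z that is not yet there into the right
    half-plane, where [carg] applies. *)
Lemma polar (z : C) : exists a, z = (Cmod z * cis a)%C.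
Proof.
  assert (P : forall w : C, 0 < Re w -> exists a, w = (Cmod w * cis a)%C)
    by (intros w Hw; exists (carg w); now apply carg_spec).
  assert (Q : forall (w : C) b, (exists a, (w * cis b)%C = (Cmod (w * cis b) * cis a)%C) ->
                exists a, w = (Cmod w * cis a)%C).
  { intros w b [a Ha]. exists (a - b). unfold Rminus. rewrite cis_plus, cis_opp.
    rewrite Cmod_mult, Cmod_cis, Rmult_1_r in Ha.
    transitivity (w * cis b * Cconj (cis b))%C.
    - rewrite <- Cmult_assoc, <- Cmod2_conj, Cmod_cis. unfold Cmult, RtoC; simpl.
      destruct w; simpl. f_equal; ring.
    - rewrite Ha. ring. }
  destruct (Rtotal_order (Re z) 0) as [H|[H|H]].
  - apply (Q z PI), P. destruct z as [x y]; simpl in *. rewrite cos_PI, sin_PI. lra.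
  - destruct (Rtotal_order (Im z) 0) as [K|[K|K]].
    + apply (Q z (PI / 2)), P. destruct z as [x y]; simpl in *. rewrite cos_PI2, sin_PI2. lra.
    + exists 0. destruct z as [x y]; simpl in *. subst. change (0, 0) with (RtoC 0). rewrite Cmod_0. unfold Cmult, RtoC; simpl; f_equal; ring.
    + apply (Q z (- (PI / 2))), P. destruct z as [x y]; simpl in *.
      rewrite cos_neg, sin_neg, cos_PI2, sin_PI2. lra.
  - now apply P.
Qed.

(** * Winding numbers *)

(** A continuous angle for [c]. Where [c] vanishes the equation imposes nothing, so nonvanishing is
    required separately wherever it matters. *)
Definition lift (c : R -> C) (th : R -> R) : Prop :=
  (forall t, continuous th t) /\
  forall t, 0 <= t <= 1 -> c t = (Cmod (c t) * cis (th t))%C.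

(* Only the direction of c on [0, 1] matters, so positive real factors are harmless; neither continuity
   of c nor c 0 = c 1 is required. *)
Definition winds (c : R -> C) (k : Z) : Prop :=
  exists th, lift c th /\ th 1 - th 0 = 2 * PI * IZR k.

(** The number b times conj a has the direction of b / a. When it lies in the right half-plane, its
    argument is [carg], and this is the correction from an angle of a to an angle of b. *)
Lemma arg_step (a b : C) (x : R) :
  0 < Re (b * Cconj a)%C -> a = (Cmod a * cis x)%C ->
  b = (Cmod b * cis (x + carg (b * Cconj a)))%C.
Proof.
  intros Hp T2. rewrite cis_plus. pose proof (carg_spec _ Hp) as E.
  assert (Ha : a <> 0%C).
  { intros E0. rewrite E0 in Hp. destruct b; simpl in Hp. lra. }
  assert (Hm : 0 < Cmod a) by (now apply Cmod_gt_0).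
  rewrite Cmod_mult, Cmod_conj in E.
  assert (Hn : RtoC (Cmod a ^ 2) <> 0%C).
  { intros E0. injection E0. simpl. nra. }
  assert (F : (b * RtoC (Cmod a ^ 2))%C =
              (Cmod b * (cis x * cis (carg (b * Cconj a))) * RtoC (Cmod a ^ 2))%C).
  { transitivity (a * (b * Cconj a))%C.
    - rewrite Cmod2_conj. ring.
    - rewrite E, T2 at 1. rewrite RtoC_mult. rewrite RtoC_pow. ring. }
  apply (f_equal (fun z => z / RtoC (Cmod a ^ 2))%C) in F.
  transitivity (b * RtoC (Cmod a ^ 2) / RtoC (Cmod a ^ 2))%C; [now field|].
  rewrite F. now field.
Qed.

(** The correction is made pointwise in t and needs no subdivision of [0, 1], because the directions
    of the two curves always differ by less than a right angle. *)
Lemma lift_step (a b : R -> C) (th : R -> R) :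
  (forall t, 0 <= t <= 1 -> ccont a t /\ ccont b t) ->
  (forall t, 0 <= t <= 1 -> 0 < Re (b t * Cconj (a t))%C) ->
  lift a th -> lift b (fun t => th t + carg (b (clamp t) * Cconj (a (clamp t)))%C).
Proof.
  intros Hc Hp [T1 T2]. split.
  - intros t. apply rcont_plus; [apply T1|].
    pose proof (clamp_I t) as I. destruct (Hc _ I) as [Ca Cb]. pose proof (Hp _ I).
    apply (rcont_carg (fun t => (b (clamp t) * Cconj (a (clamp t)))%C)); [|lra].
    assert (continuous clamp t) by (apply (rcont_clamp (fun t => t)); cont).
    cont; now apply ccont_Rcomp.
  - intros t I. rewrite clamp_id by exact I. now apply arg_step; auto.
Qed.

Lemma Cmod_pos (z : C) : z <> 0%C -> 0 < Cmod z.
Proof. apply Cmod_gt_0. Qed.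

Lemma lift_scale (c d : R -> C) (th : R -> R) :
  (forall t, 0 <= t <= 1 -> exists r, 0 < r /\ d t = (r * c t)%C) ->
  lift c th -> lift d th.
Proof.
  intros E [T1 T2]. split; [exact T1|]. intros t I. destruct (E t I) as [r [r0 ->]].
  rewrite Cmod_mult, Cmod_R, Rabs_pos_eq by lra. rewrite T2 at 1 by exact I.
  rewrite RtoC_mult. ring.
Qed.

Lemma winds_scale (c d : R -> C) (k : Z) :
  (forall t, 0 <= t <= 1 -> exists r, 0 < r /\ d t = (r * c t)%C) ->
  winds c k -> winds d k.
Proof.
  intros E [th [L K]]. exists th. split; [|exact K]. now apply (lift_scale c).
Qed.

Lemma winds_ext (c d : R -> C) (k : Z) :
  (forall t, 0 <= t <= 1 -> d t = c t) -> winds c k -> winds d k.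
Proof.
  intros E. apply winds_scale. intros t I. exists 1. split; [lra|]. rewrite E by exact I. ring.
Qed.

Lemma ccont_slice (H : R -> R -> C) (s t : R) :
  ccont (fun z : C => H (fst z) (snd z)) (s, t) -> ccont (H s) t.
Proof.
  intros K. apply (ccont_comp (fun t => (s, t)) (fun z : C => H (fst z) (snd z))); [|exact K].
  apply ccont_pair; cont.
Qed.

(** The unit vector H / |H| is uniformly continuous on the square. If both of its coordinates change
    by less than 1/2, the scalar product of the old and the new vector, which is 1 minus half the
    squared distance, stays positive. *)
Lemma homotopy_uniform (H : R -> R -> C) :
  (forall s t, 0 <= s <= 1 -> 0 <= t <= 1 -> ccont (fun z : C => H (fst z) (snd z)) (s, t)) ->
  (forall s t, 0 <= s <= 1 -> 0 <= t <= 1 -> H s t <> 0%C) ->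
  exists delta, 0 < delta /\ forall s s' t, 0 <= s <= 1 -> 0 <= s' <= 1 -> 0 <= t <= 1 ->
    Rabs (s' - s) < delta -> 0 < Re (H s' t * Cconj (H s t))%C.
Proof.
  intros Hc Hn.
  set (ux := fun s t => Re (H s t) / Cmod (H s t)).
  set (uy := fun s t => Im (H s t) / Cmod (H s t)).
  assert (Cx : forall s t, 0 <= s <= 1 -> 0 <= t <= 1 -> continuity_2d_pt ux s t).
  { intros s t Is It. apply continuity_2d_pt_filterlim. unfold ux.
    apply (rcont_div (fun z : C => Re (H (fst z) (snd z))) (fun z : C => Cmod (H (fst z) (snd z)))).
    - apply Hc; assumption.
    - apply rcont_Cmod, Hc; assumption.
    - simpl. pose proof (Cmod_pos _ (Hn s t Is It)). lra. }
  assert (Cy : forall s t, 0 <= s <= 1 -> 0 <= t <= 1 -> continuity_2d_pt uy s t).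
  { intros s t Is It. apply continuity_2d_pt_filterlim. unfold uy.
    apply (rcont_div (fun z : C => Im (H (fst z) (snd z))) (fun z : C => Cmod (H (fst z) (snd z)))).
    - apply Hc; assumption.
    - apply rcont_Cmod, Hc; assumption.
    - simpl. pose proof (Cmod_pos _ (Hn s t Is It)). lra. }
  assert (p : 0 < / 2) by lra.
  destruct (uniform_continuity_2d ux 0 1 0 1 Cx (mkposreal _ p)) as [d1 D1].
  destruct (uniform_continuity_2d uy 0 1 0 1 Cy (mkposreal _ p)) as [d2 D2].
  exists (Rmin d1 d2). split; [apply Rmin_pos; apply cond_pos|].
  intros s s' t Is Is' It Hs. pose proof (Rmin_l d1 d2). pose proof (Rmin_r d1 d2).
  assert (Z : forall d : posreal, Rabs (t - t) < d).
  { intros d. rewrite Rminus_diag, Rabs_R0. apply cond_pos. }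
  assert (X : Rabs (ux s' t - ux s t) < / 2) by (apply (D1 s t s' t); auto; lra).
  assert (Y : Rabs (uy s' t - uy s t) < / 2) by (apply (D2 s t s' t); auto; lra).
  pose proof (Cmod_pos _ (Hn s t Is It)) as P. pose proof (Cmod_pos _ (Hn s' t Is' It)) as P'.
  assert (U : forall z : C, 0 < Cmod z ->
     Re z = Cmod z * (Re z / Cmod z) /\ Im z = Cmod z * (Im z / Cmod z) /\
     (Re z / Cmod z)² + (Im z / Cmod z)² = 1).
  { intros z Hz. split; [field; lra|]. split; [field; lra|].
    pose proof (Cmod2_alt z). unfold Rsqr. replace (_ + _) with ((Re z ^ 2 + Im z ^ 2) / Cmod z ^ 2) by (field; lra).
    rewrite <- H2. field. lra. }
  destruct (U _ P) as [E1 [E2 E3]]. destruct (U _ P') as [F1 [F2 F3]].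
  fold (ux s t) in E1, E3. fold (uy s t) in E2, E3. fold (ux s' t) in F1, F3. fold (uy s' t) in F2, F3.
  assert (Ec : Re (H s' t * Cconj (H s t))%C = Re (H s' t) * Re (H s t) + Im (H s' t) * Im (H s t)).
  { destruct (H s' t), (H s t); simpl; ring. }
  rewrite Ec, E1, E2, F1, F2.
  apply Rabs_def2 in X. apply Rabs_def2 in Y. unfold Rsqr in *.
  replace (_ + _) with (Cmod (H s' t) * Cmod (H s t) * (ux s' t * ux s t + uy s' t * uy s t)) by ring.
  apply Rmult_lt_0_compat; [nra|]. nra.
Qed.

(** The parameter s advances in N steps of length 1 / N below the uniform delta, and each step is a
    [lift_step]. Closedness is only a premise of the second conclusion, so that paths can be lifted
    too. *)
Lemma lift_homotopy (H : R -> R -> C) (th0 : R -> R) :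
  (forall s t, 0 <= s <= 1 -> 0 <= t <= 1 -> ccont (fun z : C => H (fst z) (snd z)) (s, t)) ->
  (forall s t, 0 <= s <= 1 -> 0 <= t <= 1 -> H s t <> 0%C) ->
  lift (H 0) th0 ->
  exists th1, lift (H 1) th1 /\
    ((forall s, 0 <= s <= 1 -> exists r, 0 < r /\ H s 1 = (r * H s 0)%C) ->
       th1 1 - th1 0 = th0 1 - th0 0).
Proof.
  intros Hc Hn L0. destruct (homotopy_uniform H Hc Hn) as [d [d0 Hd]].
  destruct (archimed_cor1 d d0) as [N [N1 N0]].
  assert (PN : 0 < INR N) by (now apply lt_0_INR).
  assert (K : forall n, (n <= N)%nat -> exists th1, lift (H (INR n / INR N)) th1 /\
    ((forall s, 0 <= s <= 1 -> exists r, 0 < r /\ H s 1 = (r * H s 0)%C) ->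
       th1 1 - th1 0 = th0 1 - th0 0)).
  { induction n as [|n IH]; intros Hle.
    - exists th0. simpl. unfold Rdiv. rewrite Rmult_0_l. now split.
    - destruct IH as [th [L E]]; [lia|].
      assert (I : forall m, (m <= N)%nat -> 0 <= INR m / INR N <= 1).
      { intros m Hm. apply le_INR in Hm. pose proof (pos_INR m). split.
        - apply Rle_mult_inv_pos; lra.
        - apply (Rmult_le_reg_r (INR N)); [lra|]. unfold Rdiv. rewrite Rmult_assoc, Rinv_l; lra. }
      assert (I1 := I n ltac:(lia)). assert (I2 := I (S n) Hle).
      set (a := INR n / INR N) in *. set (b := INR (S n) / INR N) in *.
      assert (Q : forall t, 0 <= t <= 1 ->
        0 < Re (H (b) t * Cconj (H a t))%C).
      { intros t It. apply Hd; auto. unfold a, b. rewrite S_INR.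
        replace ((INR n + 1) / INR N - INR n / INR N) with (/ INR N) by (field; lra).
        rewrite Rabs_pos_eq; [exact N1|]. left. now apply Rinv_0_lt_compat. }
      eexists. split.
      + apply (lift_step (H a) (H (b)) th); try assumption.
        intros t It. split; apply ccont_slice; apply Hc; assumption.
      (* End point and starting point of both curves differ by positive factors, so the correction
         is the same at t = 1 and t = 0 and the total angle is preserved. *)
      + intros P. simpl. rewrite !clamp_id by lra.
        destruct (P _ I1) as [r [r0 ->]]. destruct (P _ I2) as [r' [r0' ->]].
        replace (r' * H (b) 0 * Cconj (r * H (a) 0))%C
          with (RtoC (r' * r) * (H (b) 0 * Cconj (H a 0)))%C.
        * rewrite carg_scale by nra. rewrite <- (E P). ring.
        * rewrite Cmult_conj, RtoC_mult. replace (Cconj r) with (RtoC r); [ring|].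
          unfold Cconj, RtoC; simpl; f_equal; ring. }
  destruct (K N (le_n N)) as [th [L E]]. exists th. replace 1 with (INR N / INR N) at 1 by (field; lra).
  now split.
Qed.

Lemma winds_homotopy (H : R -> R -> C) (k : Z) :
  (forall s t, 0 <= s <= 1 -> 0 <= t <= 1 -> ccont (fun z : C => H (fst z) (snd z)) (s, t)) ->
  (forall s t, 0 <= s <= 1 -> 0 <= t <= 1 -> H s t <> 0%C) ->
  (forall s, 0 <= s <= 1 -> exists r, 0 < r /\ H s 1 = (r * H s 0)%C) ->
  winds (H 0) k -> winds (H 1) k.
Proof.
  intros Hc Hn Hl [th0 [L0 E0]]. destruct (lift_homotopy H th0 Hc Hn L0) as [th1 [L1 E1]].
  exists th1. split; [exact L1|]. now rewrite E1.
Qed.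

(** Path lifting as a case of homotopy lifting: the curves c (s t) join the constant curve, which
    has a constant angle, to c. *)
Lemma lift_exists (c : R -> C) :
  (forall t, 0 <= t <= 1 -> ccont c t) -> (forall t, 0 <= t <= 1 -> c t <> 0%C) ->
  exists th, lift c th.
Proof.
  intros Hc Hn.
  assert (I : forall s t, 0 <= s <= 1 -> 0 <= t <= 1 -> 0 <= s * t <= 1) by (intros; nra).
  destruct (polar (c 0)) as [a Ha].
  destruct (lift_homotopy (fun s t => c (s * t)) (fun _ => a)) as [th [[L1 L2] _]].
  - intros s t Is It. apply (ccont_Rcomp (fun z : C => fst z * snd z)); [cont|].
    now apply Hc, I.
  - intros s t Is It. now apply Hn, I.
  - split; [intros; apply rcont_const|]. intros t It. now rewrite Rmult_0_l.
  - exists th. split; [exact L1|]. intros t It. specialize (L2 t It).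
    now rewrite Rmult_1_l in L2.
Qed.

Lemma Cmod_cancel (z a b : C) : z <> 0%C -> (Cmod z * a = Cmod z * b)%C -> a = b.
Proof.
  intros Hz H. apply Cmod_pos in Hz.
  assert (N : RtoC (Cmod z) <> 0%C) by (intros E; injection E; lra).
  apply (f_equal (fun w => / RtoC (Cmod z) * w)%C) in H.
  rewrite !Cmult_assoc, !Cinv_l, !Cmult_1_l in H; assumption.
Qed.

Lemma winds_exists (c : R -> C) :
  (forall t, 0 <= t <= 1 -> ccont c t) -> (forall t, 0 <= t <= 1 -> c t <> 0%C) ->
  (exists r, 0 < r /\ c 1 = (r * c 0)%C) -> exists k, winds c k.
Proof.
  intros Hc Hn [r [r0 E]]. destruct (lift_exists c Hc Hn) as [th L].
  assert (E' : cis (th 1) = cis (th 0)).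
  { destruct L as [_ L]. assert (L0 := L 0 ltac:(lra)). assert (L1 := L 1 ltac:(lra)).
    apply (Cmod_cancel (c 1)); [apply Hn; lra|]. rewrite <- L1, E, Cmod_mult, Cmod_R, Rabs_pos_eq by lra.
    rewrite L0 at 1. rewrite RtoC_mult. ring. }
  destruct (cis_eq _ _ E') as [k Hk]. exists k, th. now split.
Qed.

(** Otherwise the intermediate value theorem yields a value halfway between two consecutive
    multiples of 2 PI. *)
Lemma discrete_const (d : R -> R) :
  (forall t, continuous d t) ->
  (forall t, 0 <= t <= 1 -> exists k : Z, d t = 2 * PI * IZR k) -> d 0 = d 1.
Proof.
  intros Hc Hk. pose proof PI_RGT_0.
  destruct (Hk 0 ltac:(lra)) as [m Hm]. destruct (Hk 1 ltac:(lra)) as [n Hn].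
  destruct (Z.eq_dec m n) as [->|D]; [lra|exfalso].
  set (l := Z.min m n).
  destruct (IVT_gen_consistent d 0 1 (2 * PI * (IZR l + / 2)) Hc) as [x [Ix Hx]].
  - rewrite Hm, Hn. destruct (Z.lt_total m n) as [L|[L|L]]; [|easy|].
    + unfold l. rewrite Z.min_l by lia. assert (M : (m + 1 <= n)%Z) by lia.
      apply IZR_le in M. rewrite plus_IZR in M. rewrite Rmin_left, Rmax_right by nra. split; nra.
    + unfold l. rewrite Z.min_r by lia. assert (M : (n + 1 <= m)%Z) by lia.
      apply IZR_le in M. rewrite plus_IZR in M. rewrite Rmin_right, Rmax_left by nra. split; nra.
  - rewrite Rmin_left, Rmax_right in Ix by lra. destruct (Hk x Ix) as [j Hj].
    assert (E : IZR j = IZR l + / 2) by (apply (Rmult_eq_reg_l (2 * PI)); lra).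
    assert (E2 : IZR (2 * j) = IZR (2 * l + 1)) by (rewrite plus_IZR, !mult_IZR; lra).
    apply eq_IZR in E2. lia.
Qed.

Lemma winds_unique (c : R -> C) (k l : Z) :
  (forall t, 0 <= t <= 1 -> c t <> 0%C) -> winds c k -> winds c l -> k = l.
Proof.
  intros Hn [th [[L1 L2] E]] [th' [[L1' L2'] E']].
  assert (D : th 0 - th' 0 = th 1 - th' 1).
  { apply (discrete_const (fun t => th t - th' t)).
    - intros t. apply rcont_minus; auto.
    - intros t It. apply cis_eq, (Cmod_cancel (c t)); [auto|]. now rewrite <- L2, <- L2'. }
  pose proof PI_RGT_0. apply eq_IZR, (Rmult_eq_reg_l (2 * PI)); lra.
Qed.

Lemma winds_mult (a b : R -> C) (k l : Z) :
  winds a k -> winds b l -> winds (fun t => a t * b t)%C (k + l).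
Proof.
  intros [th [[L1 L2] E]] [th' [[L1' L2'] E']]. exists (fun t => th t + th' t). split.
  - split; [intros; apply rcont_plus; auto|]. intros t It.
    rewrite Cmod_mult, cis_plus, RtoC_mult. rewrite (L2 t It) at 1. rewrite (L2' t It) at 1. ring.
  - rewrite plus_IZR. lra.
Qed.

Lemma winds_conj (a : R -> C) (k : Z) : winds a k -> winds (fun t => Cconj (a t)) (- k).
Proof.
  intros [th [[L1 L2] E]]. exists (fun t => - th t). split.
  - split; [intros; apply rcont_opp; auto|]. intros t It.
    rewrite Cmod_conj, cis_opp. rewrite (L2 t It) at 1. rewrite Cmult_conj. f_equal.
    unfold Cconj, RtoC; simpl; f_equal; ring.
  - rewrite opp_IZR. lra.
Qed.

Lemma winds_const (z : C) : winds (fun _ => z) 0.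
Proof.
  destruct (polar z) as [a Ha]. exists (fun _ => a). split; [|lra].
  split; [intros; apply rcont_const|auto].
Qed.

Lemma winds_pow (a : R -> C) (k : Z) (n : nat) :
  winds a k -> winds (fun t => a t ^ n)%C (Z.of_nat n * k).
Proof.
  intros Ha. induction n as [|n IH]; simpl Cpow; [exact (winds_const 1)|].
  replace (Z.of_nat (S n) * k)%Z with (k + Z.of_nat n * k)%Z by lia. now apply winds_mult.
Qed.

Lemma winds_re_conj (a b : R -> C) (k : Z) :
  (forall t, 0 <= t <= 1 -> ccont a t /\ ccont b t) ->
  (exists r, 0 < r /\ a 1 = (r * a 0)%C) -> (exists r, 0 < r /\ b 1 = (r * b 0)%C) ->
  (forall t, 0 <= t <= 1 -> 0 < Re (b t * Cconj (a t))%C) ->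
  winds a k -> winds b k.
Proof.
  intros Hc [r [r0 E]] [r' [r0' E']] Hp [th [L K]]. eexists. split.
  - exact (lift_step a b th Hc Hp L).
  - simpl. rewrite !clamp_id by lra. rewrite E, E'.
    replace (r' * b 0 * Cconj (r * a 0))%C with (RtoC (r' * r) * (b 0 * Cconj (a 0)))%C.
    + rewrite carg_scale by nra. rewrite <- K. ring.
    + rewrite Cmult_conj, RtoC_mult. replace (Cconj r) with (RtoC r); [ring|].
      unfold Cconj, RtoC; simpl; f_equal; ring.
Qed.

Lemma Cmod_lt_re (z w : C) : Cmod (z - w) < Cmod z -> 0 < Re (w * Cconj z)%C.
Proof.
  intros H. assert (K : Cmod (z - w) ^ 2 < Cmod z ^ 2).
  { pose proof (Cmod_ge_0 (z - w)). nra. }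
  rewrite !Cmod2_alt in K. destruct z as [x y], w as [u v]; simpl in *. nra.
Qed.

(** The leash is shorter than the distance to the origin, so b / a stays within distance 1 of 1 and
    hence in the right half-plane. *)
Lemma winds_leash (a b : R -> C) (k : Z) :
  (forall t, 0 <= t <= 1 -> ccont a t /\ ccont b t) -> a 1 = a 0 -> b 1 = b 0 ->
  (forall t, 0 <= t <= 1 -> Cmod (a t - b t) < Cmod (a t)) ->
  winds a k -> winds b k.
Proof.
  intros Hc Ea Eb Hl. apply winds_re_conj; [exact Hc| | |].
  - exists 1. split; [lra|]. rewrite Ea. ring.
  - exists 1. split; [lra|]. rewrite Eb. ring.
  - intros t It. now apply Cmod_lt_re, Hl.
Qed.

Lemma winds_cis : winds (fun t => cis (2 * PI * t)) 1.
Proof.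
  exists (fun t => 2 * PI * t). split; [split|].
  - intros t. cont.
  - intros t _. rewrite Cmod_cis. ring.
  - ring.
Qed.

(* The loop K t (u t) / (K t 0 * K 0 (u t)), with inverses replaced by conjugates, deforms the
   diagonal quotient at u = 1 to a constant direction at u = 0. *)
Lemma winds_torus (K : R -> R -> C) (a b : Z) :
  (forall s t, 0 <= s <= 1 -> 0 <= t <= 1 -> ccont (fun z : C => K (fst z) (snd z)) (s, t)) ->
  (forall s t, 0 <= s <= 1 -> 0 <= t <= 1 -> K s t <> 0%C) ->
  (forall s, 0 <= s <= 1 -> K s 1 = K s 0) -> (forall t, 0 <= t <= 1 -> K 1 t = K 0 t) ->
  winds (fun s => K s 0) a -> winds (fun t => K 0 t) b -> winds (fun t => K t t) (a + b).
Proof.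
  intros Hc Hn P1 P2 Wa Wb.
  assert (I : forall s t, 0 <= s <= 1 -> 0 <= t <= 1 -> 0 <= s * t <= 1) by (intros; nra).
  assert (J : 0 <= 0 <= 1) by lra.
  assert (Q : forall z : C, z <> 0%C -> 0 < Cmod z ^ 2) by (intros z Hz; apply Cmod_pos in Hz; nra).
  assert (W : winds (fun t => K t t * Cconj (K t 0) * Cconj (K 0 t))%C 0).
  { apply (winds_ext (fun t => K t (1 * t)%R * Cconj (K t 0) * Cconj (K 0 (1 * t)%R))%C).
    { intros t _. now rewrite Rmult_1_l. }
    apply (winds_homotopy (fun u t => K t (u * t)%R * Cconj (K t 0) * Cconj (K 0 (u * t)%R))%C).
    - intros s t Is It. simpl.
      assert (A : ccont (fun z : C => K (snd z) (fst z * snd z)) (s, t)).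
      { apply (ccont_comp (fun z : C => (snd z, fst z * snd z)) (fun z : C => K (fst z) (snd z))).
        - apply ccont_pair; cont.
        - apply Hc; simpl; auto. }
      assert (B : ccont (fun z : C => K (snd z) 0) (s, t)).
      { apply (ccont_comp (fun z : C => (snd z, 0)) (fun z : C => K (fst z) (snd z))).
        - apply ccont_pair; cont.
        - apply Hc; auto. }
      assert (C : ccont (fun z : C => K 0 (fst z * snd z)) (s, t)).
      { apply (ccont_comp (fun z : C => (0, fst z * snd z)) (fun z : C => K (fst z) (snd z))).
        - apply ccont_pair; cont.
        - apply Hc; simpl; auto. }
      cont.
    - intros s t Is It. repeat apply Cmult_neq_0; try (apply Cmod_gt_0; rewrite Cmod_conj; apply Cmod_gt_0);
        apply Hn; auto.
    (* By periodicity the values at t = 1 and t = 0 are |K 0 u|^2 and |K 0 0|^2 times the conjugate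
       of K 0 0. *)
    - intros u Iu. rewrite !Rmult_1_r, !Rmult_0_r.
      exists (Cmod (K 0 u) ^ 2 / Cmod (K 0 0) ^ 2).
      pose proof (Q _ (Hn 0 u J Iu)). pose proof (Q _ (Hn 0 0 J J)).
      split; [apply Rdiv_lt_0_compat; assumption|].
      rewrite !P2 by lra.
      transitivity (RtoC (Cmod (K 0 u) ^ 2) * Cconj (K 0 0))%C; [rewrite Cmod2_conj; ring|].
      transitivity (RtoC (Cmod (K 0 u) ^ 2 / Cmod (K 0 0) ^ 2)%R * (RtoC (Cmod (K 0 0) ^ 2) * Cconj (K 0 0)))%C.
      + rewrite Cmult_assoc, <- RtoC_mult. do 2 f_equal. field. intros E0. rewrite E0 in H0. simpl in H0. lra.
      + rewrite (Cmod2_conj (K 0 0)). ring.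
    - apply (winds_scale (fun t => Cconj (K 0 0))); [|apply winds_const].
      intros t It. exists (Cmod (K t 0) ^ 2). split; [apply Q, Hn; auto|].
      rewrite Rmult_0_l, Cmod2_conj. ring. }
  pose proof (winds_mult _ _ _ _ (winds_mult _ _ _ _ Wa Wb) W) as T.
  rewrite Z.add_0_r in T. revert T. apply winds_scale. intros t It.
  assert (P : 0 < Cmod (K t 0) ^ 2 * Cmod (K 0 t) ^ 2) by (apply Rmult_lt_0_compat; apply Q, Hn; auto).
  exists (/ (Cmod (K t 0) ^ 2 * Cmod (K 0 t) ^ 2)). split; [now apply Rinv_0_lt_compat|].
  transitivity (RtoC (/ (Cmod (K t 0) ^ 2 * Cmod (K 0 t) ^ 2)) *
                (RtoC (Cmod (K t 0) ^ 2 * Cmod (K 0 t) ^ 2) * K t t))%C.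
  - rewrite Cmult_assoc, <- RtoC_mult, Rinv_l by lra. ring.
  - rewrite (RtoC_mult (_ ^ 2)), !Cmod2_conj. ring.
Qed.

(* The angle runs once from -PI to PI, since c meets the negative real axis only at its end points. *)
Lemma winds_slit (c : R -> C) (delta : R) :
  (forall t, 0 <= t <= 1 -> ccont c t) -> (forall t, 0 <= t <= 1 -> c t <> 0%C) ->
  Re (c 0) < 0 -> Im (c 0) = 0 -> c 1 = c 0 -> 0 < delta ->
  (forall t, 0 < t < 1 -> Re (c t) <= 0 -> Im (c t) <> 0) ->
  (forall t, 0 < t < delta -> Im (c t) < 0) ->
  (forall t, 1 - delta < t < 1 -> 0 < Im (c t)) ->
  winds c 1.
Proof.
  intros Hc Hn R0 I0 E1 d0 Hs Hd Hu. pose proof PI_RGT_0 as Pi.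
  destruct (lift_exists c Hc Hn) as [th0 [L1 L2]].
  assert (CPI : forall x, c 0 = (Cmod (c 0) * cis x)%C -> cis x = cis (- PI)).
  { intros x Hx. apply (Cmod_cancel (c 0)); [apply Hn; lra|]. rewrite <- Hx.
    destruct (c 0) as [u v]; simpl in *. subst v.
    unfold cis. rewrite cos_neg, sin_neg, cos_PI, sin_PI.
    unfold Cmod; simpl. replace (u * (u * 1) + 0 * (0 * 1)) with (Rsqr (- u)) by (unfold Rsqr; ring).
    rewrite sqrt_Rsqr by lra. unfold Cmult, RtoC; simpl; f_equal; ring. }
  (* The angle is shifted by a multiple of 2 PI so that it starts at -PI. *)
  set (th := fun t => th0 t + (- PI - th0 0)).
  assert (L : lift c th).
  { split; [intros t; apply rcont_plus; [apply L1|apply rcont_const]|]. intros t It.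
    unfold th. rewrite cis_plus. unfold Rminus. rewrite cis_plus, (cis_opp (th0 0)).
    rewrite (CPI (th0 0)) by (apply L2; lra).
    rewrite (L2 t It) at 1. f_equal. rewrite <- (Cmult_1_r (cis (th0 t))) at 1. f_equal.
    rewrite <- Cmod2_conj, Cmod_cis. unfold RtoC; f_equal; ring. }
  assert (T0 : th 0 = - PI) by (unfold th; ring).
  clearbody th. clear th0 L1 L2. destruct L as [L1 L2].
  assert (Si : forall t, 0 <= t <= 1 -> Im (c t) = Cmod (c t) * sin (th t)).
  { intros t It. rewrite (L2 t It) at 1. simpl. ring. }
  assert (Co : forall t, 0 <= t <= 1 -> Re (c t) = Cmod (c t) * cos (th t)).
  { intros t It. rewrite (L2 t It) at 1. simpl. ring. }
  assert (Cp : forall t, 0 <= t <= 1 -> 0 < Cmod (c t)) by (intros; apply Cmod_pos; auto).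
  assert (Nodd : forall t, 0 < t < 1 -> th t <> - PI /\ th t <> PI).
  { intros t It. assert (It' : 0 <= t <= 1) by lra.
    assert (G : cos (th t) = -1 -> sin (th t) = 0 -> False).
    { intros G1 G2. apply (Hs t It).
      - rewrite (Co t It'), G1. specialize (Cp t It'). lra.
      - rewrite (Si t It'), G2. ring. }
    split; intros E; apply G; rewrite E; rewrite ?cos_neg, ?sin_neg, ?cos_PI, ?sin_PI; lra. }
  destruct (proj1 (rcont_eps th 0) (L1 0) (PI / 2) ltac:(lra)) as [e0 [e0p He0]].
  destruct (proj1 (rcont_eps th 1) (L1 1) (PI / 2) ltac:(lra)) as [e1 [e1p He1]].
  set (m := Rmin delta (Rmin e0 (Rmin e1 1)) / 2).
  assert (Hm : 0 < m /\ m < delta /\ m < e0 /\ m < e1 /\ m < 1).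
  { assert (0 < Rmin delta (Rmin e0 (Rmin e1 1))) by (repeat apply Rmin_pos; lra).
    pose proof (Rmin_l delta (Rmin e0 (Rmin e1 1))).
    pose proof (Rmin_r delta (Rmin e0 (Rmin e1 1))).
    pose proof (Rmin_l e0 (Rmin e1 1)). pose proof (Rmin_r e0 (Rmin e1 1)).
    pose proof (Rmin_l e1 1). pose proof (Rmin_r e1 1). unfold m. lra. }
  clearbody m. destruct Hm as [m0 [m1 [m2 [m3 m4]]]].
  (* Near -PI, a negative sine means that the angle lies above -PI. *)
  assert (Near0 : - PI < th m < PI).
  { assert (A : Rabs (th m - th 0) < PI / 2) by (apply He0; rewrite Rabs_pos_eq; lra).
    rewrite T0 in A. apply Rabs_def2 in A.
    assert (B : sin (th m) < 0).
    { assert (D := Hd m ltac:(lra)). rewrite Si in D by lra. specialize (Cp m ltac:(lra)). nra. }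
    split; [|lra]. apply Rnot_le_lt. intros Q.
    assert (0 <= sin (th m + 2 * PI)) by (apply sin_ge_0; lra).
    rewrite sin_plus, cos_2PI, sin_2PI in H. lra. }
  assert (All : forall t, 0 < t < 1 -> - PI < th t < PI).
  { intros t It. split; apply Rnot_le_lt; intros Q.
    - destruct (IVT_gen_consistent th m t (- PI) L1) as [x [Ix Hx]].
      + rewrite Rmin_right, Rmax_left; lra.
      + assert (0 < x < 1).
        { split; [eapply Rlt_le_trans; [|apply Ix]; apply Rmin_glb_lt; lra
                 |eapply Rle_lt_trans; [apply Ix|]; apply Rmax_lub_lt; lra]. }
        destruct (Nodd x H). contradiction.
    - destruct (IVT_gen_consistent th m t PI L1) as [x [Ix Hx]].
      + rewrite Rmin_left, Rmax_right; lra.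
      + assert (0 < x < 1).
        { split; [eapply Rlt_le_trans; [|apply Ix]; apply Rmin_glb_lt; lra
                 |eapply Rle_lt_trans; [apply Ix|]; apply Rmax_lub_lt; lra]. }
        destruct (Nodd x H). contradiction. }
  assert (A : Rabs (th (1 - m) - th 1) < PI / 2).
  { apply He1. rewrite <- Rabs_Ropp, Rabs_pos_eq; lra. }
  apply Rabs_def2 in A. specialize (All (1 - m) ltac:(lra)).
  assert (B : 0 < sin (th (1 - m))).
  { assert (D := Hu (1 - m) ltac:(lra)). rewrite Si in D by lra. specialize (Cp (1 - m) ltac:(lra)). nra. }
  destruct (cis_eq (th 1) (- PI)) as [k Hk].
  { apply CPI. rewrite <- E1. apply L2. lra. }
  (* Just before t = 1 the angle is inside (-PI, PI), which leaves -PI and PI as final angles; the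
     first is impossible because the sine there is positive. *)
  assert (K : (k = 0 \/ k = 1)%Z).
  { assert (K1 : -1 < IZR k) by nra. assert (K2 : IZR k < 2) by nra.
    apply lt_IZR in K1. apply lt_IZR in K2. lia. }
  destruct K as [-> | ->].
  - exfalso. assert (0 <= sin (th (1 - m) + 2 * PI - PI)) by (apply sin_ge_0; lra).
    replace (th (1 - m) + 2 * PI - PI) with (th (1 - m) + PI) in H by ring.
    rewrite neg_sin in H. lra.
  - exists th. split; [split; assumption|]. rewrite T0. lra.
Qed.

(** * Indices of isolated zeros *)

Lemma ccont_paste (f g h : C -> C) (z : C) :
  ccont f z -> ccont g z -> f z = g z -> (forall y, h y = f y \/ h y = g y) -> ccont h z.
Proof.
  intros Hf Hg E Hh. apply ccont2_eps. intros eps e0.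
  destruct (proj1 (ccont2_eps f z) Hf eps e0) as [d1 [p1 D1]].
  destruct (proj1 (ccont2_eps g z) Hg eps e0) as [d2 [p2 D2]].
  exists (Rmin d1 d2). split; [now apply Rmin_pos|]. intros q Hq.
  pose proof (Rmin_l d1 d2). pose proof (Rmin_r d1 d2).
  assert (Ez : h z = f z) by (destruct (Hh z); congruence).
  rewrite Ez. destruct (Hh q) as [-> | ->]; [apply D1; lra|]. rewrite E. apply D2; lra.
Qed.

Lemma discrete_const_all (d : R -> R) :
  (forall t, continuous d t) ->
  (forall t, 0 <= t <= 1 -> exists k : Z, d t = 2 * PI * IZR k) ->
  forall t, 0 <= t <= 1 -> d t = d 0.
Proof.
  intros Hc Hk t It.
  assert (E : d (t * 0) = d (t * 1)).
  { apply (discrete_const (fun u => d (t * u))).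
    - intros u. apply (continuous_comp (fun u => t * u) d); [cont|apply Hc].
    - intros u Iu. apply Hk. nra. }
  rewrite Rmult_0_r, Rmult_1_r in E. now symmetry.
Qed.

Lemma polar01 (z : C) : exists a, 0 <= a < 1 /\ z = (Cmod z * cis (2 * PI * a))%C.
Proof.
  destruct (polar z) as [x Hx]. pose proof PI_RGT_0.
  destruct (archimed (x / (2 * PI))) as [A1 A2].
  set (n := up (x / (2 * PI))) in *.
  exists (x / (2 * PI) - IZR n + 1). split; [lra|].
  replace (2 * PI * (x / (2 * PI) - IZR n + 1)) with (x + 2 * PI * IZR (1 - n)).
  - rewrite cis_plus, cis_2PI_Z, Cmult_1_r. exact Hx.
  - rewrite minus_IZR. field. lra.
Qed.

(** Winding number 0 makes the angle of [u] periodic, hence a function of the direction of z alone;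
    [Phi] is its extension along rays. It has no limit at 0 in general, and the bound [M] is what
    replaces continuity there. *)
Lemma circle_log (u : R -> C) :
  (forall t, ccont u t) -> (forall t, u t <> 0%C) -> (forall t, u (t + 1) = u t) ->
  winds u 0 ->
  exists (Phi : C -> R) (M : R),
    (forall z : C, z <> 0%C -> continuous Phi z) /\ (forall z : C, Rabs (Phi z) <= M) /\
    (forall (z : C) (a : R), z <> 0%C -> z = (Cmod z * cis (2 * PI * a))%C -> u a = (Cmod (u a) * cis (Phi z))%C).
Proof.
  intros Hc Hn Hp Hw.
  (* The angle is lifted over [-1, 2], so that a small change of a position in [0, 1) never leaves
     the range. *)
  assert (L : exists th, lift (fun t => u (3 * t - 1)) th).
  { apply lift_exists; auto.
    intros t _. apply (ccont_Rcomp (fun t => 3 * t - 1)); [cont|apply Hc]. }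
  destruct L as [th0 [L1 L2]].
  set (th := fun a => th0 ((a + 1) / 3)).
  assert (Tc : forall a, continuous th a).
  { intros a. apply (continuous_comp (fun a => (a + 1) / 3) th0); [unfold Rdiv; cont|apply L1]. }
  assert (Tu : forall a, -1 <= a <= 2 -> u a = (Cmod (u a) * cis (th a))%C).
  { intros a Ia. unfold th. replace a with (3 * ((a + 1) / 3) - 1) at 1 2 by field.
    apply L2. lra. }
  clearbody th. clear th0 L1 L2.
  assert (Kz : forall a, -1 <= a <= 1 -> exists k : Z, th (a + 1) - th a = 2 * PI * IZR k).
  { intros a Ia. apply cis_eq, (Cmod_cancel (u a)); [apply Hn|].
    rewrite <- Tu by lra. rewrite <- (Hp a). symmetry. apply Tu. lra. }
  assert (T1 : th 1 - th 0 = 0).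
  { destruct (Kz 0 ltac:(lra)) as [k Hk]. rewrite Rplus_0_l in Hk.
    assert (k = 0%Z); [|subst; lra].
    apply (winds_unique u); auto. exists th. split; [split|]; auto. intros t It. apply Tu. lra. }
  (* The increment over a period is a continuous multiple of 2 PI, hence constant, and it is 0 at a
     = 0. *)
  assert (Tp : forall a, -1 <= a <= 1 -> th (a + 1) = th a).
  { assert (G := discrete_const_all (fun t => th (2 * t - 1 + 1) - th (2 * t - 1))).
    assert (G' : forall t, 0 <= t <= 1 -> th (2 * t - 1 + 1) - th (2 * t - 1) =
                 th (2 * 0 - 1 + 1) - th (2 * 0 - 1)).
    { apply G.
      - intros t. apply rcont_minus.
        + apply (continuous_comp (fun t => 2 * t - 1 + 1) th); [cont|apply Tc].
        + apply (continuous_comp (fun t => 2 * t - 1) th); [cont|apply Tc].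
      - intros t It. apply Kz. lra. }
    assert (H0 := G' (/ 2) ltac:(lra)). replace (2 * / 2 - 1) with 0 in H0 by field.
    rewrite Rplus_0_l in H0.
    intros a Ia. assert (H1 := G' ((a + 1) / 2) ltac:(lra)).
    replace (2 * ((a + 1) / 2) - 1) with a in H1 by field. lra. }
  set (arg := fun z => proj1_sig (constructive_indefinite_description _ (polar01 z))).
  assert (Harg : forall z, 0 <= arg z < 1 /\ z = (Cmod z * cis (2 * PI * arg z))%C).
  { intros z. unfold arg. now destruct (constructive_indefinite_description _ (polar01 z)). }
  clearbody arg.
  assert (Teq : forall x y : R, 0 <= x < 1 -> -1 < y < 2 -> (exists k : Z, y = x + IZR k) -> th y = th x).
  { intros x y Ix Iy [k ->].
    assert (K : (k = -1 \/ k = 0 \/ k = 1)%Z).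
    { assert (K1 : -2 < IZR k) by lra. assert (K2 : IZR k < 2) by lra.
      apply lt_IZR in K1. apply lt_IZR in K2. lia. }
    destruct K as [-> |[-> | ->]].
    - rewrite <- Tp by lra. f_equal. lra.
    - f_equal. lra.
    - apply Tp. lra. }
  assert (Cz : forall (z : C) (x y : R), z <> 0%C -> z = (Cmod z * cis (2 * PI * x))%C ->
               z = (Cmod z * cis (2 * PI * y))%C -> exists k : Z, y = x + IZR k).
  { intros z x y Hz H1 H2. destruct (cis_eq (2 * PI * y) (2 * PI * x)) as [k Hk].
    - apply (Cmod_cancel z); [exact Hz|]. now rewrite <- H1, <- H2.
    - exists k. pose proof PI_RGT_0. apply (Rmult_eq_reg_l (2 * PI)); lra. }
  assert (Ta : forall a, 0 <= a <= 1 -> continuity_pt (fun a => Rabs (th a)) a).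
  { intros a _. apply continuity_pt_filterlim.
    apply (rcont_comp th Rabs); [apply Tc|apply Rcontinuity_abs]. }
  destruct (continuity_ab_maj (fun a => Rabs (th a)) 0 1 ltac:(lra) Ta) as [mx [Hmx _]].
  exists (fun z => th (arg z)), (Rabs (th mx)). split; [|split].
  - intros z Hz. destruct (Harg z) as [Ia Ea]. pose proof PI_RGT_0 as Pi.
    set (q := fun y => (y * Cconj z)%C).
    assert (Qc : ccont q z) by (unfold q; cont).
    assert (Qz : q z = RtoC (Cmod z ^ 2)) by (unfold q; now rewrite Cmod2_conj).
    assert (Pz : 0 < Cmod z ^ 2) by (apply Cmod_pos in Hz; nra).
    assert (Gc : continuous (fun y => arg z + carg (q y) / (2 * PI)) z).
    { apply rcont_plus; [apply rcont_const|]. unfold Rdiv. apply rcont_mult; [|apply rcont_const].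
      apply rcont_carg; [exact Qc|]. rewrite Qz. simpl. simpl in Pz. lra. }
    assert (Gz : carg (q z) = 0).
    { rewrite Qz. unfold carg; simpl. unfold Rdiv. rewrite Rmult_0_l. apply atan_0. }
    destruct (proj1 (rcont2_eps _ _) Gc 1 ltac:(lra)) as [d1 [p1 D1]].
    destruct (proj1 (rcont2_eps _ _) (proj1 Qc) (Cmod z ^ 2) Pz) as [d2 [p2 D2]].
    (* The choice [arg] may jump, but for y near z it differs by an integer from
       [arg z + carg (q y) / (2 * PI)], which is continuous at z, and [th] takes the same value at
       both. *)
    apply (continuous_ext_loc (fun y : C => th (arg y)) (fun y : C => th (arg z + carg (q y) / (2 * PI)))).
    + exists (mkposreal _ (Rmin_pos _ _ p1 p2)). intros y [By1 By2]. simpl in By1, By2.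
      change (Rabs (fst y - fst z) < Rmin d1 d2) in By1.
      change (Rabs (snd y - snd z) < Rmin d1 d2) in By2.
      pose proof (Rmin_l d1 d2). pose proof (Rmin_r d1 d2).
      assert (X1 := D1 y ltac:(lra) ltac:(lra)). assert (X2 := D2 y ltac:(lra) ltac:(lra)).
      simpl in X1. rewrite Gz in X1. rewrite Qz in X2. unfold Re at 2, RtoC, fst in X2.
      apply Rabs_def2 in X1. apply Rabs_def2 in X2.
      assert (Re0 : 0 < Re (y * Cconj z)%C) by (unfold q in X2; lra).
      assert (E := arg_step z y _ Re0 Ea).
      apply Teq; [apply Harg|unfold Rdiv in X1; lra|].
      apply (Cz y).
      * intros ->. rewrite Cmult_0_l in Re0. simpl in Re0. lra.
      * apply Harg.
      * rewrite E at 1. do 2 f_equal. fold (q y). field. lra.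
    + apply (continuous_comp (fun y => arg z + carg (q y) / (2 * PI)) th); [exact Gc|apply Tc].
  - intros z. apply Hmx. destruct (Harg z). lra.
  - intros z a Hz Ea. destruct (Harg z) as [Ia Eb].
    destruct (Cz z _ _ Hz Eb Ea) as [k ->].
    assert (E : u (arg z + IZR k) = u (arg z)).
    { assert (Pn : forall n : nat, forall x, u (x + INR n) = u x).
      { induction n as [|n IH]; intros x; [simpl; f_equal; ring|].
        rewrite S_INR, <- Rplus_assoc, Hp. apply IH. }
      destruct (Z.le_gt_cases 0 k).
      - rewrite <- (Z2Nat.id k), <- INR_IZR_INZ by lia. apply Pn.
      - rewrite <- (Pn (Z.to_nat (- k)) (arg z + IZR k)). f_equal.
        rewrite INR_IZR_INZ, Z2Nat.id, opp_IZR by lia. ring. }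
    rewrite E. apply Tu. lra.
Qed.

Lemma Cminus_eq_0 (a b : C) : (a - b)%C = 0%C -> a = b.
Proof. intros H. replace a with (a - b + b)%C by ring. rewrite H. ring. Qed.

Lemma Cmod_minus_sym (a b : C) : Cmod (a - b) = Cmod (b - a).
Proof. rewrite <- Cmod_opp. f_equal. ring. Qed.

Lemma ccont_ext_open (h k : C -> C) (z : C) (phi : C -> R) (r : R) :
  continuous phi z -> phi z < r -> (forall y, phi y < r -> h y = k y) -> ccont h z -> ccont k z.
Proof.
  intros Hp Hz E. destruct (proj1 (rcont2_eps phi z) Hp (r - phi z) ltac:(lra)) as [d [d0 Hd]].
  apply (ccont_ext_loc h k z d d0). intros q Hq. apply E.
  apply dist2_lt in Hq. assert (K := Hd q (proj1 Hq) (proj2 Hq)). apply Rabs_def2 in K. lra.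
Qed.

(* On the disc of radius rho, interpolate between the constant 1 at the centre and U on the circle,
   where U = exp (i Phi). *)
Lemma patch (U : C -> C) (p : C) (rad rho : R) :
  0 < rho < rad ->
  (forall z, 0 < Cmod (z - p) < rad -> ccont U z /\ U z <> 0%C) ->
  (forall z, Cmod (z - p) = rho -> Cmod (U z) = 1) ->
  winds (fun t => U (p + rho * cis (2 * PI * t))%C) 0 ->
  exists U' : C -> C, (forall z, rho <= Cmod (z - p) -> U' z = U z) /\
    (forall z, Cmod (z - p) < rad -> ccont U' z /\ U' z <> 0%C).
Proof.
  intros Hr HU H1 Hw.
  assert (Hm : forall t, Cmod (p + rho * cis (2 * PI * t) - p)%C = rho).
  { intros t. replace (p + rho * cis (2 * PI * t) - p)%C with (rho * cis (2 * PI * t))%C by ring.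
    rewrite Cmod_mult, Cmod_R, Cmod_cis, Rabs_pos_eq; lra. }
  destruct (circle_log (fun t => U (p + rho * cis (2 * PI * t))%C)) as [Phi [M [Pc [Pb Pu]]]].
  - intros t. apply (ccont_comp (fun t => (p + rho * cis (2 * PI * t))%C)); [cont|].
    apply HU. rewrite Hm. lra.
  - intros t. apply HU. rewrite Hm. lra.
  - intros t. do 3 f_equal. rewrite Rmult_plus_distr_l, Rmult_1_r, cis_plus, cis_1. ring.
  - exact Hw.
  (* The factor is 1 on the circle and tends to 0 at the centre, where it outweighs the bounded but
     possibly discontinuous [Phi]. *)
  - set (psi := fun z => Rmin (Cmod (z - p)) rho / rho * Phi (z - p)%C).
    assert (Hr1 : forall z, continuous (fun z => Cmod (z - p)) z) by (intros z; cont).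
    assert (psic : forall z, continuous psi z).
    { intros z. destruct (classic (z = p)) as [->|Hz].
      - apply rcont2_eps. intros eps e0.
        assert (M0 : 0 <= M) by (eapply Rle_trans; [apply Rabs_pos|apply (Pb 0%C)]).
        assert (A : 0 < eps * rho / (M + 1)) by (apply Rdiv_lt_0_compat; nra).
        destruct (proj1 (rcont2_eps _ p) (Hr1 p) _ A) as [d [d0 Hd]].
        exists d. split; [exact d0|]. intros q Q1 Q2. specialize (Hd q Q1 Q2). simpl in Hd.
        replace (p - p)%C with (RtoC 0) in Hd by ring. rewrite Cmod_0 in Hd.
        rewrite Rminus_0_r in Hd. rewrite Rabs_pos_eq in Hd by apply Cmod_ge_0.
        unfold psi. replace (p - p)%C with (RtoC 0) by ring. rewrite Cmod_0.
        rewrite (Rmin_left 0 rho) by lra. unfold Rdiv at 2. rewrite !Rmult_0_l, Rminus_0_r.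
        rewrite Rabs_mult. specialize (Pb (q - p)%C).
        assert (B : 0 <= Rmin (Cmod (q - p)) rho / rho < eps / (M + 1)).
        { pose proof (Cmod_ge_0 (q - p)). split.
          - apply Rle_mult_inv_pos; [apply Rmin_glb; lra|lra].
          - apply (Rmult_lt_reg_r rho); [lra|].
            replace (Rmin (Cmod (q - p)) rho / rho * rho) with (Rmin (Cmod (q - p)) rho) by (field; lra).
            eapply Rle_lt_trans; [apply Rmin_l|].
            replace (eps / (M + 1) * rho) with (eps * rho / (M + 1)) by (field; lra). exact Hd. }
        rewrite (Rabs_pos_eq (_ / _)) by lra.
        assert (0 < eps / (M + 1)) by (apply Rdiv_lt_0_compat; lra).
        replace eps with (eps / (M + 1) * (M + 1)) by (field; lra).
        pose proof (Rabs_pos (Phi (q - p)%C)). nra.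
      - apply rcont_mult.
        + unfold Rdiv. apply rcont_mult; [|apply rcont_const]. apply rcont_min; [apply Hr1|apply rcont_const].
        + apply (rcont_ccomp (fun z => (z - p)%C) Phi); [cont|]. apply Pc.
          intros E. now apply Hz, Cminus_eq_0. }
    assert (Edge : forall z, Cmod (z - p) = rho -> U z = cis (psi z)).
    { intros z Hz. destruct (polar01 (z - p)) as [a [_ Ha]].
      assert (N0 : (z - p)%C <> 0%C) by (intros E; rewrite E, Cmod_0 in Hz; lra).
      assert (E := Pu (z - p)%C a N0 Ha). rewrite Hz in Ha.
      assert (Ez : (p + rho * cis (2 * PI * a))%C = z) by (rewrite <- Ha; ring).
      cbv beta in E. rewrite Ez in E. rewrite (H1 z Hz), Cmult_1_l in E. rewrite E.
      unfold psi. rewrite Hz, Rmin_left by lra. f_equal. field. lra. }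
    set (U' := fun z => if Rlt_dec (Cmod (z - p)) rho then cis (psi z) else U z).
    assert (cpsi : forall z, ccont (fun z => cis (psi z)) z) by (intros z; apply ccont_cis, psic).
    assert (cisn : forall x, cis x <> 0%C).
    { intros x E. assert (K := Cmod_cis x). rewrite E, Cmod_0 in K. lra. }
    exists U'. split.
    + intros z Hz. unfold U'. destruct (Rlt_dec _ _); [lra|reflexivity].
    + intros z Hz. destruct (Rtotal_order (Cmod (z - p)) rho) as [L|[L|L]]; split.
      * apply (ccont_ext_open (fun z => cis (psi z)) U' z (fun z => Cmod (z - p)) rho); auto.
        intros y Hy. unfold U'. destruct (Rlt_dec _ _); [reflexivity|lra].
      * unfold U'. destruct (Rlt_dec _ _); [apply cisn|lra].
      * apply (ccont_paste (fun z => cis (psi z)) U); auto.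
        -- apply HU. lra.
        -- symmetry. now apply Edge.
        -- intros y. unfold U'. destruct (Rlt_dec _ _); auto.
      * unfold U'. destruct (Rlt_dec _ _); [lra|]. apply HU. lra.
      * apply (ccont_ext_open U U' z (fun z => - Cmod (z - p)) (- rho)).
        -- apply rcont_opp, Hr1.
        -- lra.
        -- intros y Hy. unfold U'. destruct (Rlt_dec _ _); [lra|reflexivity].
        -- apply HU. lra.
      * unfold U'. destruct (Rlt_dec _ _); [lra|]. apply HU. lra.
Qed.

(* z ^ k up to a positive factor: for negative k the inverse of z is replaced by its conjugate. *)
Definition zdir (k : Z) (z : C) : C :=
  match k with
  | Z0 => 1
  | Zpos n => z ^ Pos.to_nat n
  | Zneg n => Cconj z ^ Pos.to_nat n
  end.

Lemma zdir_neq_0 (k : Z) (z : C) : z <> 0%C -> zdir k z <> 0%C.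
Proof.
  intros Hz. destruct k; simpl.
  - intros E. injection E. lra.
  - now apply Cpow_nz.
  - apply Cpow_nz, Cmod_gt_0. rewrite Cmod_conj. now apply Cmod_gt_0.
Qed.

Lemma ccont_zdir {U : UniformSpace} (k : Z) (f : U -> C) (x : U) :
  ccont f x -> ccont (fun u => zdir k (f u)) x.
Proof. intros Hf. destruct k; simpl; cont. Qed.

Lemma winds_zdir (c : R -> C) (k j : Z) : winds c j -> winds (fun t => zdir k (c t)) (k * j).
Proof.
  intros H. destruct k as [|n|n]; simpl zdir.
  - apply winds_const.
  - rewrite <- positive_nat_Z. now apply winds_pow.
  - replace (Z.neg n * j)%Z with (Z.of_nat (Pos.to_nat n) * - j)%Z by lia.
    apply winds_pow. now apply winds_conj.
Qed.

Lemma zdir_opp (k : Z) (z : C) : (zdir (- k) z * zdir k z)%C = RtoC (Cmod (zdir k z) ^ 2).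
Proof.
  rewrite Cmod2_conj. destruct k; simpl.
  - unfold Cmult, Cconj, RtoC; simpl. f_equal; ring.
  - rewrite Cpow_conj. ring.
  - rewrite Cpow_conj, Cconj_conj. ring.
Qed.

(** The radius [b] is complex, so circles with any starting direction are covered. The comparison
    with the w-plane uses b = r / alpha. *)
Definition index (V : C -> C) (p : C) (k : Z) : Prop :=
  exists rho, 0 < rho /\ forall b : C, 0 < Cmod b < rho ->
    winds (fun t => V (p + b * cis (2 * PI * t))%C) k.

Lemma circle_loop (p b : C) (V : C -> C) : V (p + b * cis (2 * PI * 1))%C = V (p + b * cis (2 * PI * 0))%C.
Proof. now rewrite Rmult_1_r, Rmult_0_r, cis_1, cis_0. Qed.

Lemma Cmod_mult_cis (b : C) (t : R) : Cmod (b * cis t) = Cmod b.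
Proof. rewrite Cmod_mult, Cmod_cis. ring. Qed.

(** Any two circles in the punctured disc are homotopic there: the radius is interpolated linearly
    while the starting direction turns. *)
Lemma index_exists (V : C -> C) (p : C) (d : R) : 0 < d ->
  (forall z, 0 < Cmod (z - p) < d -> ccont V z /\ V z <> 0%C) -> exists k, index V p k.
Proof.
  intros d0 HV.
  assert (Hm : forall b t, Cmod (p + b * cis t - p)%C = Cmod b).
  { intros b t. rewrite <- (Cmod_mult_cis b t). f_equal. ring. }
  assert (A : Cmod (d / 2)%R = d / 2) by (rewrite Cmod_R; apply Rabs_pos_eq; lra).
  destruct (winds_exists (fun t => V (p + (d / 2)%R * cis (2 * PI * t))%C)) as [k Hk].
  - intros t _. apply (ccont_comp (fun t => (p + (d / 2)%R * cis (2 * PI * t))%C)); [cont|].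
    apply HV. rewrite Hm, A. lra.
  - intros t _. apply HV. rewrite Hm, A. lra.
  - exists 1. split; [lra|]. rewrite (circle_loop p _ V). ring.
  - exists k, d. split; [exact d0|]. intros b Hb. destruct (polar b) as [x Hx].
    set (r := fun s => (1 - s) * (d / 2) + s * Cmod b).
    assert (Hr : forall s, 0 <= s <= 1 -> 0 < r s < d) by (intros s Is; unfold r; split; nra).
    set (h := fun s t => (p + r s * cis (s * x) * cis (2 * PI * t))%C).
    assert (Mh : forall s t, 0 <= s <= 1 -> 0 < Cmod (h s t - p) < d).
    { intros s t Is. unfold h. rewrite Hm, Cmod_mult_cis, Cmod_R.
      rewrite Rabs_pos_eq; [apply Hr; exact Is|]. left. now apply Hr. }
    apply (winds_ext (fun t => V (h 1 t))).
    { intros t _. unfold h, r. rewrite Hx at 1. do 3 f_equal. f_equal; do 2 f_equal; ring. }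
    apply (winds_homotopy (fun s t => V (h s t))).
    + intros s t Is It. apply (ccont_comp (fun z : C => h (fst z) (snd z)) V); [|now apply HV, Mh].
      unfold h, r. cont.
    + intros s t Is It. now apply HV, Mh.
    + intros s Is. exists 1. split; [lra|]. unfold h. rewrite (circle_loop p _ V). ring.
    + revert Hk. apply winds_ext. intros t _. unfold h, r. rewrite !Rmult_0_l, cis_0, Cmult_1_r.
      do 4 f_equal. ring.
Qed.

Lemma index_nonzero (V : C -> C) (p : C) (d : R) : 0 < d ->
  (forall z, Cmod (z - p) < d -> ccont V z /\ V z <> 0%C) -> index V p 0.
Proof.
  intros d0 HV. exists d. split; [exact d0|]. intros b [_ Hb].
  assert (M : forall s t, 0 <= s <= 1 -> Cmod (p + s * b * cis t - p)%C < d).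
  { intros s t Is. replace (p + s * b * cis t - p)%C with (s * b * cis t)%C by ring.
    rewrite Cmod_mult_cis, Cmod_mult, Cmod_R, Rabs_pos_eq by lra.
    pose proof (Cmod_ge_0 b). nra. }
  apply (winds_ext (fun t => V (p + 1%R * b * cis (2 * PI * t))%C)).
  { intros t _. f_equal. ring. }
  apply (winds_homotopy (fun s t => V (p + s * b * cis (2 * PI * t))%C)).
  - intros s t Is It. apply (ccont_comp (fun z : C => (p + fst z * b * cis (2 * PI * snd z))%C) V).
    + cont.
    + now apply HV, M.
  - intros s t Is It. now apply HV, M.
  - intros s Is. exists 1. split; [lra|]. rewrite (circle_loop p _ V). ring.
  - apply (winds_ext (fun t => V p)); [|apply winds_const]. intros t _. f_equal. ring.
Qed.

Lemma index_scale (V W : C -> C) (p : C) (k : Z) (d : R) : 0 < d ->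
  (forall z, 0 < Cmod (z - p) < d -> exists r, 0 < r /\ W z = (r * V z)%C) ->
  index V p k -> index W p k.
Proof.
  intros d0 E [rho [r0 H]]. exists (Rmin rho d). split; [now apply Rmin_pos|].
  intros b [B0 B1]. pose proof (Rmin_l rho d). pose proof (Rmin_r rho d).
  apply (winds_scale (fun t => V (p + b * cis (2 * PI * t))%C)); [|apply H; lra].
  intros t _. apply E. replace (p + b * cis (2 * PI * t) - p)%C with (b * cis (2 * PI * t))%C by ring.
  rewrite Cmod_mult_cis. lra.
Qed.

Lemma index_mult (V W : C -> C) (p : C) (k l : Z) :
  index V p k -> index W p l -> index (fun z => V z * W z)%C p (k + l).
Proof.
  intros [r1 [p1 H1]] [r2 [p2 H2]]. exists (Rmin r1 r2). split; [now apply Rmin_pos|].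
  intros b [B0 B1]. pose proof (Rmin_l r1 r2). pose proof (Rmin_r r1 r2).
  apply (winds_mult (fun t => V (p + b * cis (2 * PI * t))%C)); [apply H1|apply H2]; lra.
Qed.

Lemma index_zdir (p : C) (k : Z) : index (fun z => zdir k (z - p)%C) p k.
Proof.
  exists 1. split; [lra|]. intros b [B0 _].
  cut (winds (fun t => zdir k (p + b * cis (2 * PI * t) - p)%C) (k * 1)); [now rewrite Z.mul_1_r|].
  apply (winds_zdir (fun t => (p + b * cis (2 * PI * t) - p)%C)).
  apply (winds_ext (fun t => b * cis (2 * PI * t))%C); [intros; ring|].
  apply (winds_mult (fun _ => b) _ 0 1); [apply winds_const|apply winds_cis].
Qed.

Lemma ccont_normalize {U : UniformSpace} (f : U -> C) (x : U) :
  ccont f x -> f x <> 0%C -> ccont (fun u => (/ Cmod (f u))%R * f u)%C x.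
Proof.
  intros Hf Hn. apply (ccont_mult (fun u => RtoC (/ Cmod (f u))%R)); [|exact Hf].
  apply ccont_RtoC, rcont_inv; [now apply rcont_Cmod|]. apply Cmod_pos in Hn. lra.
Qed.

Lemma finite_ball (p : C) (l : list C) : ~ In p l ->
  exists d, 0 < d /\ forall q, In q l -> d <= Cmod (q - p).
Proof.
  induction l as [|a l IH]; intros H.
  - exists 1. split; [lra|]. intros q [].
  - destruct IH as [d [d0 Hd]]; [intros K; apply H; now right|].
    assert (A : 0 < Cmod (a - p)).
    { apply Cmod_pos. intros E. apply H. left. now apply Cminus_eq_0. }
    exists (Rmin d (Cmod (a - p))). split; [now apply Rmin_pos|].
    intros q [<-|Hq]; [apply Rmin_r|]. eapply Rle_trans; [apply Rmin_l|auto].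
Qed.

Lemma path_ball (gam : R -> C) (p : C) :
  (forall t, 0 <= t <= 1 -> ccont gam t) -> (forall t, 0 <= t <= 1 -> gam t <> p) ->
  exists d, 0 < d /\ forall t, 0 <= t <= 1 -> d <= Cmod (gam t - p).
Proof.
  intros Hc Hn.
  destruct (continuity_ab_min (fun t => Cmod (gam t - p)) 0 1) as [m [Hm Im]]; [lra| |].
  - intros t It. apply continuity_pt_filterlim. apply (rcont_Cmod (fun t => (gam t - p)%C)).
    apply ccont_minus; [auto|apply ccont_const].
  - exists (Cmod (gam m - p)). split; [|exact Hm].
    apply Cmod_pos. intros E. apply (Hn m Im). now apply Cminus_eq_0.
Qed.

(** Induction on the list of zeros, with the field generalised: one zero is patched away, and the
    new field has the same indices at the remaining ones. *)
Lemma index_sum (D : C -> Prop) (gam : R -> C) (e : Z) :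
  (forall t, 0 <= t <= 1 -> ccont gam t) -> (forall t, 0 <= t <= 1 -> D (gam t)) ->
  (forall U : C -> C, (forall z, D z -> ccont U z /\ U z <> 0%C) -> winds (fun t => U (gam t)) 0) ->
  forall (S : list C) (ks : list Z) (V : C -> C), NoDup S ->
    (forall p, In p S -> forall t, 0 <= t <= 1 -> gam t <> p) ->
    (forall p, In p S -> winds (fun t => (gam t - p)%C) e) ->
    (forall p, In p S -> interior2 D p) ->
    (forall z, D z -> ~ In z S -> ccont V z /\ V z <> 0%C) ->
    Forall2 (index V) S ks -> winds (fun t => V (gam t)) (e * sumZ ks).
Proof.
  intros Gc GD Hnull. induction S as [|p S IH]; intros ks V ND Gn Ge SD HV HI.
  - inversion HI. subst. simpl. rewrite Z.mul_0_r. apply Hnull. intros z Dz. now apply HV.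
  - inversion HI as [|p' k S' ks' Ik HI' E1 E2]. subst. inversion ND as [|p' S' Np ND']. subst.
    destruct (finite_ball p S Np) as [d1 [p1 H1]].
    destruct (path_ball gam p Gc (Gn p (or_introl eq_refl))) as [d2 [p2 H2]].
    destruct (SD p (or_introl eq_refl)) as [d3 [p3 H3]].
    set (W := fun z => (V z * zdir (- k) (z - p))%C).
    (* Normalised because [patch] asks for modulus one on the circle. *)
    set (U := fun z => ((/ Cmod (W z))%R * W z)%C).
    (* The open disc of radius d about p lies in D and contains neither another listed zero nor a
       point of the curve. *)
    set (d := Rmin d1 (Rmin d2 d3)).
    assert (Hd : 0 < d /\ d <= d1 /\ d <= d2 /\ d <= d3).
    { unfold d. split; [repeat apply Rmin_pos; assumption|].
      pose proof (Rmin_l d1 (Rmin d2 d3)). pose proof (Rmin_r d1 (Rmin d2 d3)).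
      pose proof (Rmin_l d2 d3). pose proof (Rmin_r d2 d3). lra. }
    clearbody d. destruct Hd as [d0 [Hd1 [Hd2 Hd3]]].
    assert (Np0 : forall z : C, 0 < Cmod (z - p) -> (z - p)%C <> 0%C).
    { intros z Hz E. rewrite E, Cmod_0 in Hz. lra. }
    assert (HW : forall z, D z -> ~ In z (p :: S) -> ccont W z /\ W z <> 0%C).
    { intros z Dz Nz. destruct (HV z Dz Nz) as [V1 V2]. split.
      - apply ccont_mult; [exact V1|]. apply (ccont_zdir (- k) (fun z => (z - p)%C)). cont.
      - apply Cmult_neq_0; [exact V2|]. apply zdir_neq_0. intros E. apply Nz. left.
        symmetry. now apply Cminus_eq_0. }
    assert (HU : forall z, D z -> ~ In z (p :: S) -> ccont U z /\ U z <> 0%C /\ Cmod (U z) = 1 /\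
      exists r, 0 < r /\ U z = (r * W z)%C).
    { intros z Dz Nz. destruct (HW z Dz Nz) as [W1 W2]. apply Cmod_pos in W2 as W3.
      assert (M1 : Cmod (U z) = 1).
      { unfold U. rewrite Cmod_mult, Cmod_R, Rabs_pos_eq; [field; lra|].
        left. now apply Rinv_0_lt_compat. }
      split; [now apply ccont_normalize|]. split.
      - intros E. rewrite E, Cmod_0 in M1. lra.
      - split; [exact M1|]. exists (/ Cmod (W z)). split; [now apply Rinv_0_lt_compat|reflexivity]. }
    assert (Ball : forall z : C, 0 < Cmod (z - p) < d -> D z /\ ~ In z (p :: S)).
    { intros z Hz. split.
      - apply H3. eapply Rle_lt_trans; [apply dist2_Cmod|]. lra.
      - intros [E|Iz].
        + apply (Np0 z); [lra|]. rewrite E. ring.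
        + specialize (H1 z Iz). lra. }
    assert (IU : index U p 0).
    { apply (index_scale W U p 0 d d0).
      - intros z Hz. destruct (Ball z Hz) as [B1 B2]. apply (HU z B1 B2).
      - rewrite <- (Z.add_opp_diag_r k). apply index_mult; [exact Ik|apply index_zdir]. }
    destruct IU as [rho0 [r0 HR]].
    set (rho := Rmin rho0 d / 2).
    assert (Hrho : 0 < rho /\ rho < rho0 /\ rho < d).
    { assert (0 < Rmin rho0 d) by (now apply Rmin_pos).
      pose proof (Rmin_l rho0 d). pose proof (Rmin_r rho0 d). unfold rho. lra. }
    clearbody rho. destruct Hrho as [R0 [R1 R2]].
    destruct (patch U p d rho) as [U' [HU1 HU2]].
    { lra. }
    { intros z Hz. destruct (Ball z Hz) as [B1 B2]. destruct (HU z B1 B2) as [? [? _]]. now split. }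
    { intros z Hz. destruct (Ball z) as [B1 B2]; [lra|]. apply (HU z B1 B2). }
    { apply HR. rewrite Cmod_R, Rabs_pos_eq; lra. }
    (* For a point q at distance at least d from p, the disc of radius d - rho about q misses the
       patched disc. *)
    assert (Far : forall q : C, d <= Cmod (q - p) -> forall z : C, Cmod (z - q) < d - rho ->
                    0 < Cmod (z - p) /\ U' z = U z).
    { intros q Hq z Hz. assert (T := Cmod_triangle (q - z) (z - p)).
      replace (q - z + (z - p))%C with (q - p)%C in T by ring.
      rewrite Cmod_minus_sym in Hz. split; [lra|]. apply HU1. lra. }
    assert (HV' : forall z, D z -> ~ In z S -> ccont U' z /\ U' z <> 0%C).
    { intros z Dz Nz. destruct (Rlt_dec (Cmod (z - p)) d) as [L|L]; [now apply HU2|].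
      assert (Nz' : ~ In z (p :: S)).
      { intros [E|Iz]; [|contradiction]. subst z. apply L.
        replace (p - p)%C with (RtoC 0) by ring. now rewrite Cmod_0. }
      destruct (HU z Dz Nz') as [U1 [U2 _]]. split.
      - apply (ccont_ext_open U U' z (fun y => - Cmod (y - p)) (- rho)); auto; [cont|lra|].
        intros y Hy. symmetry. apply HU1. lra.
      - rewrite HU1 by lra. exact U2. }
    assert (HI2 : Forall2 (index U') S ks').
    { assert (Q : forall q, In q S -> index (fun z => zdir (- k) (z - p)%C) q 0).
      { intros q Hq. apply (index_nonzero _ q d d0). intros z Hz.
        assert (T := Cmod_triangle (q - z) (z - p)).
        replace (q - z + (z - p))%C with (q - p)%C in T by ring.
        rewrite (Cmod_minus_sym q z) in T. specialize (H1 q Hq).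
        split; [apply (ccont_zdir (- k) (fun z => (z - p)%C)); cont|].
        apply zdir_neq_0, Np0. lra. }
      (* Near q the new field is a positive multiple of V times a power of z - p or of its
         conjugate; that factor has no zero near q and so has index 0 there. *)
      assert (Q2 : forall q j, In q S -> index V q j -> index U' q j).
      { intros q j Hq Hj.
        destruct (finite_ball q (remove (fun x y => excluded_middle_informative (x = y)) q S)) as [m [m0 Hm]].
        { apply remove_In. }
        destruct (SD q (or_intror Hq)) as [m' [m0' Hm']].
        apply (index_scale W U' q j (Rmin (d - rho) (Rmin m m'))).
        - repeat apply Rmin_pos; lra.
        - intros z [Z0 Z1].
          pose proof (Rmin_l (d - rho) (Rmin m m')). pose proof (Rmin_r (d - rho) (Rmin m m')).
          pose proof (Rmin_l m m'). pose proof (Rmin_r m m').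
          assert (Hqp := H1 q Hq).
          destruct (Far q ltac:(lra) z ltac:(lra)) as [F1 ->].
          apply HU.
          + apply Hm'. eapply Rle_lt_trans; [apply dist2_Cmod|]. lra.
          + intros [E|Iz].
            * subst z. replace (p - p)%C with (RtoC 0) in F1 by ring. rewrite Cmod_0 in F1. lra.
            * assert (K : In z (remove (fun x y => excluded_middle_informative (x = y)) q S)).
              { apply in_in_remove; [|exact Iz]. intros E. subst z.
                replace (q - q)%C with (RtoC 0) in Z0 by ring. rewrite Cmod_0 in Z0. lra. }
              specialize (Hm z K). lra.
        - rewrite <- (Z.add_0_r j). apply index_mult; [exact Hj|now apply Q]. }
      clear - HI' Q2. induction HI' as [|q j S ks Hj HI IH]; constructor.
      - apply Q2; [now left|exact Hj].
      - apply IH. intros q' j' Hq'. apply Q2. now right. }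
    assert (T := IH ks' U' ND' (fun q Hq => Gn q (or_intror Hq)) (fun q Hq => Ge q (or_intror Hq))
                   (fun q Hq => SD q (or_intror Hq)) HV' HI2).
    (* The factor is put back: along the curve V is a positive multiple of [U'] times
       [zdir k (gam t - p)], and the latter winds k e times. *)
    assert (T2 := winds_zdir _ k _ (Ge p (or_introl eq_refl))).
    simpl sumZ. replace (e * (k + sumZ ks'))%Z with (e * sumZ ks' + k * e)%Z by ring.
    assert (T3 := winds_mult _ _ _ _ T T2). revert T3. apply winds_scale. intros t It.
    assert (G0 : d <= Cmod (gam t - p)) by (specialize (H2 t It); lra).
    rewrite HU1 by lra.
    assert (GN : ~ In (gam t) (p :: S)) by (intros K; now apply (Gn _ K t It)).
    destruct (HU _ (GD t It) GN) as [_ [_ [_ [r [rp ->]]]]].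
    assert (Zp : 0 < Cmod (zdir k (gam t - p)) ^ 2).
    { assert (0 < Cmod (zdir k (gam t - p))) by (apply Cmod_pos, zdir_neq_0, Np0; lra). nra. }
    exists (/ (r * Cmod (zdir k (gam t - p)) ^ 2)). split.
    { apply Rinv_0_lt_compat, Rmult_lt_0_compat; assumption. }
    unfold W.
    replace (r * (V (gam t) * zdir (- k) (gam t - p)) * zdir k (gam t - p))%C
      with (r * (zdir (- k) (gam t - p) * zdir k (gam t - p)) * V (gam t))%C by ring.
    rewrite zdir_opp, Cmult_assoc, <- !RtoC_mult, Rinv_l by nra. ring.
Qed.

(** * Regular closed curves *)

(** The gauge at a point is at most half the value of [f] there, so the lower bound on gauges
    supplied by compactness is also a lower bound for [f]. *)
Lemma rect_pos (f : C -> R) (a b c d : R) :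
  (forall x y, a <= x <= b -> c <= y <= d -> continuous f (x, y) /\ 0 < f (x, y)) ->
  exists m, 0 < m /\ forall x y, a <= x <= b -> c <= y <= d -> m <= f (x, y).
Proof.
  intros Hf.
  assert (K : forall u v, exists e : posreal, a <= u <= b -> c <= v <= d ->
     e <= f (u, v) / 2 /\ forall x y, Rabs (x - u) < e -> Rabs (y - v) < e -> f (u, v) / 2 < f (x, y)).
  { intros u v. destruct (classic (a <= u <= b /\ c <= v <= d)) as [[Iu Iv]|N].
    - destruct (Hf u v Iu Iv) as [H1 H2].
      destruct (proj1 (rcont2_eps _ _) H1 (f (u, v) / 2) ltac:(lra)) as [e [e0 He]].
      assert (P : 0 < Rmin e (f (u, v) / 2)) by (apply Rmin_pos; lra).
      exists (mkposreal _ P). intros _ _. simpl. split; [apply Rmin_r|].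
      intros x y Hx Hy. pose proof (Rmin_l e (f (u, v) / 2)).
      assert (Q := He (x, y) ltac:(simpl; lra) ltac:(simpl; lra)). apply Rabs_def2 in Q. lra.
    - exists (mkposreal 1 Rlt_0_1). intros. exfalso. now apply N. }
  destruct (choice (fun (p : R * R) (e : posreal) => a <= fst p <= b -> c <= snd p <= d ->
     e <= f p / 2 /\ forall x y, Rabs (x - fst p) < e -> Rabs (y - snd p) < e -> f p / 2 < f (x, y)))
    as [dl Hdl].
  { intros [u v]. apply K. }
  destruct (compactness_value_2d a b c d (fun u v => dl (u, v))) as [m Hm].
  exists m. split; [apply cond_pos|]. intros x y Ix Iy.
  destruct (NNPP _ (Hm x y Ix Iy)) as [u [v [Iu [Iv [Du [Dv E]]]]]].
  destruct (Hdl (u, v) Iu Iv) as [H1 H2]. specialize (H2 x y Du Dv). lra.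
Qed.

Record regular_loop (gam dg : R -> C) : Prop := {
  rl_derive : forall t, is_derive (fun s => Re (gam s)) t (Re (dg t)) /\
                        is_derive (fun s => Im (gam s)) t (Im (dg t));
  rl_cont : forall t, ccont dg t;
  rl_period : forall t, gam (t + 1) = gam t /\ dg (t + 1) = dg t;
  rl_inj : forall s t, 0 <= s < 1 -> 0 <= t < 1 -> gam s = gam t -> s = t;
  rl_reg : forall t, dg t <> 0%C }.

Definition dot (z w : C) : R := Re z * Re w + Im z * Im w.

Lemma periodic_Z {A : Type} (u : R -> A) : (forall t, u (t + 1) = u t) ->
  forall (k : Z) t, u (t + IZR k) = u t.
Proof.
  intros Hp k t.
  assert (Pn : forall n : nat, forall x, u (x + INR n) = u x).
  { induction n as [|n IH]; intros x; [simpl; f_equal; ring|].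
    rewrite S_INR, <- Rplus_assoc, Hp. apply IH. }
  destruct (Z.le_gt_cases 0 k).
  - rewrite <- (Z2Nat.id k), <- INR_IZR_INZ by lia. apply Pn.
  - rewrite <- (Pn (Z.to_nat (- k)) (t + IZR k)). f_equal.
    rewrite INR_IZR_INZ, Z2Nat.id, opp_IZR by lia. ring.
Qed.

Lemma frac_shift (x : R) : exists k : Z, 0 <= x - IZR k < 1.
Proof. exists (up x - 1)%Z. rewrite minus_IZR. destruct (archimed x). lra. Qed.

Section Loop.
Variables (gam dg : R -> C).
Hypothesis HL : regular_loop gam dg.

Lemma rl_gamZ (k : Z) (t : R) : gam (t + IZR k) = gam t.
Proof. apply periodic_Z. intros; apply (rl_period _ _ HL). Qed.

Lemma rl_dgZ (k : Z) (t : R) : dg (t + IZR k) = dg t.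
Proof. apply periodic_Z. intros; apply (rl_period _ _ HL). Qed.

Lemma rl_gamc (t : R) : ccont gam t.
Proof.
  destruct (rl_derive _ _ HL t) as [H1 H2].
  split; apply @ex_derive_continuous; eexists; eassumption.
Qed.

Lemma rl_injZ (s t : R) : gam s = gam t -> exists k : Z, t = s + IZR k.
Proof.
  intros E. destruct (frac_shift s) as [i Hi]. destruct (frac_shift t) as [j Hj].
  exists (j - i)%Z. rewrite minus_IZR.
  assert (K : s - IZR i = t - IZR j); [|lra].
  apply (rl_inj _ _ HL); auto.
  unfold Rminus. rewrite <- !opp_IZR, !rl_gamZ. exact E.
Qed.

(** Short chords point forward along the tangent, uniformly in s. The scalar product of dg (s + v)
    and dg s is positive at v = 0 and, by compactness and periodicity, for all small v; the mean
    value theorem integrates this. *)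
Lemma rl_near : exists d, 0 < d < / 2 /\ forall s u, 0 < Rabs u <= d ->
  0 < dot (gam (s + u) - gam s) (dg s) * u.
Proof.
  set (f := fun z : C => dot (dg (fst z + snd z)) (dg (fst z))).
  assert (Cs : forall z : C, continuous f z).
  { intros z. unfold f, dot.
    assert (A : ccont (fun z : C => dg (fst z + snd z)) z)
      by (apply (ccont_Rcomp (fun z : C => fst z + snd z)); [cont|apply (rl_cont _ _ HL)]).
    assert (B : ccont (fun z : C => dg (fst z)) z)
      by (apply (ccont_Rcomp (fun z : C => fst z)); [cont|apply (rl_cont _ _ HL)]).
    destruct A, B. apply rcont_plus; now apply rcont_mult. }
  assert (F0 : forall s, 0 < f (s, 0)).
  { intros s. unfold f; simpl. rewrite Rplus_0_r.
    pose proof (Cmod_pos _ (rl_reg _ _ HL s)). pose proof (Cmod2_alt (dg s)). unfold dot. nra. }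
  destruct (rect_pos f 0 1 0 0) as [m [m0 Hm]].
  { intros x y _ Iy. replace y with 0 by lra. split; [apply Cs|apply F0]. }
  destruct (uniform_continuity_2d (fun x y => f (x, y)) 0 1 (-1) 1) with (eps := mkposreal m m0)
    as [d Hd].
  { intros x y _ _. apply continuity_2d_pt_filterlim.
    apply (continuous_ext f (fun z : C => f (fst z, snd z))); [now intros []|apply Cs]. }
  assert (D0 : 0 < Rmin d (/ 2) / 2 /\ Rmin d (/ 2) / 2 < d /\ Rmin d (/ 2) / 2 < / 2).
  { pose proof (Rmin_pos d (/ 2) (cond_pos d) ltac:(lra)).
    pose proof (Rmin_l d (/ 2)). pose proof (Rmin_r d (/ 2)). lra. }
  exists (Rmin d (/ 2) / 2). split; [lra|].
  set (e := Rmin d (/ 2) / 2) in *. clearbody e.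
  assert (P01 : forall s, 0 <= s <= 1 -> forall v, Rabs v <= e -> 0 < f (s, v)).
  { intros s Is v Hv. assert (Hv' := Rabs_le_between' v 0 e). rewrite Rminus_0_r in Hv'.
    apply Hv' in Hv.
    assert (K := Hd s 0 s v Is ltac:(lra) Is ltac:(lra)). simpl in K.
    rewrite Rminus_diag, Rabs_R0, Rminus_0_r in K.
    assert (Hm0 := Hm s 0 Is ltac:(lra)).
    assert (K' : Rabs (f (s, v) - f (s, 0)) < m) by (apply K; [lra|apply Rabs_def1; lra]).
    apply Rabs_def2 in K'. lra. }
  assert (Pa : forall s v, Rabs v <= e -> 0 < f (s, v)).
  { intros s v Hv. destruct (frac_shift s) as [k Hk].
    assert (E : f (s, v) = f (s - IZR k, v)).
    { unfold f; simpl. unfold Rminus. rewrite <- opp_IZR, rl_dgZ.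
      replace (s + IZR (- k) + v) with (s + v + IZR (- k)) by ring. now rewrite rl_dgZ. }
    rewrite E. apply P01; [lra|exact Hv]. }
  intros s u [U0 U1].
  destruct (MVT_gen (fun v => dot (gam (s + v) - gam s) (dg s)) 0 u (fun v => f (s, v))) as [x [Ix Ex]].
  - intros v _. unfold dot, f; simpl.
    assert (Sh : is_derive (fun v => s + v) v 1) by (auto_derive; [exact I|ring]).
    destruct (rl_derive _ _ HL (s + v)) as [H1 H2].
    assert (E1 := is_derive_comp (fun t => Re (gam t)) _ v _ _ H1 Sh).
    assert (E2 := is_derive_comp (fun t => Im (gam t)) _ v _ _ H2 Sh).
    unfold dot; simpl.
    set (F1 := fun v => Re (gam (s + v))). set (F2 := fun v => Im (gam (s + v))).
    change (is_derive F1 v (scal 1 (Re (dg (s + v))))) in E1.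
    change (is_derive F2 v (scal 1 (Im (dg (s + v))))) in E2.
    apply (is_derive_ext (fun v => F1 v * Re (dg s) + F2 v * Im (dg s)
             + (- Re (gam s) * Re (dg s) - Im (gam s) * Im (dg s)))).
    { intros t. unfold F1, F2, Re, Im; simpl. ring. }
    assert (X1 : ex_derive F1 v) by (eexists; eassumption).
    assert (X2 : ex_derive F2 v) by (eexists; eassumption).
    apply is_derive_unique in E1. apply is_derive_unique in E2.
    clearbody F1 F2. auto_derive; [tauto|].
    change (Derive (fun x => F1 x) v = scal 1 (Re (dg (s + v)))) in E1.
    change (Derive (fun x => F2 x) v = scal 1 (Im (dg (s + v)))) in E2.
    rewrite E1, E2. unfold scal; simpl. unfold mult; simpl. ring.
  - intros v _. apply continuity_pt_filterlim. unfold dot.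
    assert (A : ccont (fun v => gam (s + v)) v)
      by (apply (ccont_Rcomp (fun v => s + v)); [cont|apply rl_gamc]).
    assert (B : ccont (fun v => gam (s + v) - gam s)%C v) by (apply ccont_minus; [exact A|apply ccont_const]).
    destruct B as [B1 B2].
    apply (rcont_plus (fun v => Re (gam (s + v) - gam s)%C * Re (dg s))
                      (fun v => Im (gam (s + v) - gam s)%C * Im (dg s)));
      apply rcont_mult; auto; apply rcont_const.
  - cbv beta in Ex. rewrite Rplus_0_r in Ex.
    assert (Z0 : dot (gam s - gam s) (dg s) = 0).
    { unfold dot, Re, Im; simpl. ring. }
    rewrite Z0, !Rminus_0_r in Ex. rewrite Ex.
    assert (Xe : Rabs x <= e).
    { apply Rle_trans with (Rabs u); [|exact U1].
      apply Rabs_le_between in U1 as U2. unfold Rmin, Rmax in Ix.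
      destruct (Rle_dec 0 u) as [L|L].
      - rewrite !Rabs_pos_eq; lra.
      - rewrite !Rabs_left1; lra. }
    specialize (Pa s x Xe).
    assert (0 < u * u). { apply Rsqr_pos_lt. intros ->. rewrite Rabs_R0 in U0. lra. }
    nra.
Qed.

(** Long chords are nonzero by injectivity, so their length divided by the speed has a positive
    lower bound on the compact range of s and u. Half of it serves as [eta], which makes the
    inequality strict. *)
Lemma rl_tube : exists d eta, 0 < d < / 2 /\ 0 < eta /\
  (forall s u, 0 < Rabs u <= d -> 0 < dot (gam (s + u) - gam s) (dg s) * u) /\
  (forall s u, d <= u <= 1 - d -> eta * Cmod (dg s) < Cmod (gam (s + u) - gam s)).
Proof.
  destruct rl_near as [d [d0 Hd]].
  set (f := fun z : C => Cmod (gam (fst z + snd z) - gam (fst z)) / Cmod (dg (fst z))).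
  assert (Dp : forall s, 0 < Cmod (dg s)) by (intros; apply Cmod_pos, (rl_reg _ _ HL)).
  destruct (rect_pos f 0 1 d (1 - d)) as [m [m0 Hm]].
  { intros x y Ix Iy. split.
    - unfold f. apply rcont_div.
      + apply rcont_Cmod, ccont_minus.
        * apply (ccont_Rcomp (fun z : C => fst z + snd z)); [cont|apply rl_gamc].
        * apply (ccont_Rcomp (fun z : C => fst z)); [cont|apply rl_gamc].
      + apply rcont_Cmod. apply (ccont_Rcomp (fun z : C => fst z)); [cont|apply (rl_cont _ _ HL)].
      + specialize (Dp x). simpl. lra.
    - unfold f; simpl. apply Rdiv_lt_0_compat; [|apply Dp].
      apply Cmod_pos. intros E. apply Cminus_eq_0 in E. symmetry in E. apply rl_injZ in E.
      destruct E as [k Hk]. assert (Ek : y = IZR k) by lra. subst y.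
      assert (K1 : 0 < IZR k) by lra. assert (K2 : IZR k < 1) by lra.
      apply lt_IZR in K1. apply lt_IZR in K2. lia. }
  exists d, (m / 2). split; [exact d0|]. split; [lra|]. split; [exact Hd|].
  intros s u Iu. destruct (frac_shift s) as [k Hk].
  assert (K := Hm (s - IZR k) u ltac:(lra) Iu). unfold f in K; simpl in K.
  unfold Rminus in K. rewrite <- opp_IZR, rl_dgZ, rl_gamZ in K.
  replace (s + IZR (- k) + u) with (s + u + IZR (- k)) in K by ring. rewrite rl_gamZ in K.
  specialize (Dp s). apply (Rmult_le_compat_r (Cmod (dg s))) in K; [|lra]. 
  unfold Rdiv in K at 1. rewrite Rmult_assoc, Rinv_l in K by lra. nra.
Qed.

(** For positive eta the point lies to the left of the curve, at distance eta times the speed; the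
    normal vector is left unnormalised. *)
Definition normal (s eta : R) : C := (gam s + eta * (Ci * dg s))%C.

Lemma normal_period (s eta : R) (k : Z) : normal (s + IZR k) eta = normal s eta.
Proof. unfold normal. now rewrite rl_gamZ, rl_dgZ. Qed.

Lemma ccont_normal {U : UniformSpace} (f g : U -> R) (x : U) :
  continuous f x -> continuous g x -> ccont (fun u => normal (f u) (g u)) x.
Proof.
  intros Hf Hg. unfold normal.
  assert (ccont (fun u => gam (f u)) x) by (apply ccont_Rcomp; [assumption|apply rl_gamc]).
  assert (ccont (fun u => dg (f u)) x) by (apply ccont_Rcomp; [assumption|apply (rl_cont _ _ HL)]).
  cont.
Qed.

(** A collar point on the curve would give a chord orthogonal to the tangent, excluded for short
    chords, and of length at most eta0 times the speed, excluded for long ones. The second claim is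
    the jump of the winding number across the curve. *)
Lemma rl_collar : exists eta0, 0 < eta0 /\
  (forall s t eta, 0 < Rabs eta <= eta0 -> gam t <> normal s eta) /\
  (forall a b, winds (fun t => gam t - normal 0 eta0)%C a ->
               winds (fun t => gam t - normal 0 (- eta0))%C b -> (a = b + 1)%Z).
Proof.
  destruct rl_tube as [d [eta0 [d0 [e0 [Near Far]]]]].
  assert (Dp : forall s, 0 < Cmod (dg s)) by (intros; apply Cmod_pos, (rl_reg _ _ HL)).
  assert (CiM : forall e s : R, Cmod (e * (Ci * dg s))%C = Rabs e * Cmod (dg s)).
  { intros e s. rewrite !Cmod_mult, Cmod_R, Cmod_Ci. ring. }
  assert (Tube : forall s t eta, 0 < Rabs eta <= eta0 -> gam t <> normal s eta).
  { intros s t eta He E. destruct (frac_shift (t - s + d)) as [k Hk].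
    set (u := t - s - IZR k). assert (Iu : - d <= u < 1 - d) by (unfold u; lra).
    assert (Et : gam t = gam (s + u)).
    { rewrite <- (rl_gamZ (- k) t). f_equal. rewrite opp_IZR. unfold u. ring. }
    rewrite Et in E. clearbody u.
    assert (Ed : (gam (s + u) - gam s)%C = (eta * (Ci * dg s))%C) by (rewrite E; unfold normal; ring).
    destruct (Rle_lt_dec (Rabs u) d) as [L|L].
    - destruct (Req_dec u 0) as [->|Nu].
      + assert (A : Cmod (gam (s + 0) - gam s) = 0).
        { rewrite Rplus_0_r. replace (gam s - gam s)%C with (RtoC 0) by ring. apply Cmod_0. }
        rewrite Ed, CiM in A. specialize (Dp s). nra.
      + assert (A := Near s u (conj (Rabs_pos_lt u Nu) L)). rewrite Ed in A.
        destruct (dg s) as [x y]. unfold dot, Re, Im in A; simpl in A. lra.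
    - assert (Iu' : d <= u <= 1 - d).
      { unfold Rabs in L. destruct (Rcase_abs u); lra. }
      assert (A := Far s u Iu'). rewrite Ed, CiM in A. specialize (Dp s). nra. }
  exists eta0. split; [exact e0|]. split; [exact Tube|].
  intros a b Wa Wb.
  assert (A1 : Rabs eta0 = eta0) by (apply Rabs_pos_eq; lra).
  assert (A2 : Rabs (- eta0) = eta0) by (rewrite Rabs_Ropp; exact A1).
  (* The direction of the quotient of the two differences. Its real part is the squared chord length
     minus a constant, and its imaginary part is a negative multiple of the scalar product of chord
     and tangent. Hence it meets the negative axis only at the end points. *)
  set (rho := fun t => ((gam t - normal 0 eta0) * Cconj (gam t - normal 0 (- eta0)))%C).
  assert (W := winds_mult _ _ _ _ Wa (winds_conj _ _ Wb)). fold rho in W.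
  assert (Rn : forall t, rho t <> 0%C).
  { intros t. apply Cmult_neq_0.
    - intros E. apply Cminus_eq_0 in E. revert E. apply Tube. lra.
    - apply Cmod_gt_0. rewrite Cmod_conj. apply Cmod_gt_0.
      intros E. apply Cminus_eq_0 in E. revert E. apply Tube. lra. }
  assert (Rr : forall t, Re (rho t) = Cmod (gam t - gam 0) ^ 2 - eta0 ^ 2 * Cmod (dg 0) ^ 2).
  { intros t. rewrite !Cmod2_alt. unfold rho, normal.
    destruct (gam t), (gam 0), (dg 0). unfold Re, Im; simpl. ring. }
  assert (Ri : forall t, Im (rho t) = - 2 * eta0 * dot (gam t - gam 0) (dg 0)).
  { intros t. unfold rho, normal, dot. destruct (gam t), (gam 0), (dg 0). unfold Re, Im; simpl. ring. }
  assert (S1 : winds rho 1).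
  { assert (NP : forall t, 0 < t <= d -> Im (rho t) < 0).
    { intros t It. rewrite Ri. assert (N := Near 0 t). rewrite Rplus_0_l in N.
      rewrite Rabs_pos_eq in N by lra. specialize (N It). nra. }
    assert (NN : forall t, 1 - d <= t < 1 -> 0 < Im (rho t)).
    { intros t It. rewrite Ri. assert (N := Near 0 (t - 1)). rewrite Rplus_0_l in N.
      rewrite Rabs_left in N by lra. specialize (N ltac:(lra)).
      replace (gam (t - 1)) with (gam t) in N; [nra|].
      rewrite <- (rl_gamZ 1 (t - 1)). f_equal. ring. }
    apply (winds_slit rho d).
    - intros t _. unfold rho. assert (ccont gam t) by apply rl_gamc. cont.
    - intros; apply Rn.
    - rewrite Rr. replace (gam 0 - gam 0)%C with (RtoC 0) by ring. rewrite Cmod_0.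
      specialize (Dp 0). assert (0 < eta0 ^ 2 * Cmod (dg 0) ^ 2) by (apply Rmult_lt_0_compat; nra). lra.
    - rewrite Ri. unfold dot, Re, Im; simpl. ring.
    - unfold rho. rewrite <- (rl_gamZ 1 0), Rplus_0_l. reflexivity.
    - lra.
    - intros t It Hr. destruct (Rle_lt_dec t d) as [L|L]; [specialize (NP t ltac:(lra)); lra|].
      destruct (Rle_lt_dec (1 - d) t) as [L'|L']; [specialize (NN t ltac:(lra)); lra|].
      exfalso. assert (F := Far 0 t ltac:(lra)). rewrite Rplus_0_l in F. rewrite Rr in Hr.
      specialize (Dp 0). assert (0 < eta0 * Cmod (dg 0)) by nra.
      replace (eta0 ^ 2 * Cmod (dg 0) ^ 2) with ((eta0 * Cmod (dg 0)) ^ 2) in Hr by ring. nra.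
    - intros t It. apply NP. lra.
    - intros t It. apply NN. lra. }
  assert (E : (a + - b = 1)%Z) by (apply (winds_unique rho); auto). lia.
Qed.

(** The foot is a nearest point of the curve, where the derivative of the squared distance vanishes;
    so p lies on the normal there. *)
Lemma rl_nearest (p : C) : (forall t, gam t <> p) ->
  exists t a, a <> 0 /\ p = normal t a /\
    forall u t', 0 < u <= 1 -> gam t' <> normal t (u * a).
Proof.
  intros Hp.
  destruct (continuity_ab_min (fun t => Cmod (gam t - p)) 0 1) as [m [Hm _]]; [lra| |].
  { intros t It. apply continuity_pt_filterlim. apply (rcont_Cmod (fun t => (gam t - p)%C)).
    apply ccont_minus; [apply rl_gamc|apply ccont_const]. }
  assert (Hg : forall t, Cmod (gam m - p) <= Cmod (gam t - p)).
  { intros t. destruct (frac_shift t) as [k Hk].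
    rewrite <- (rl_gamZ (- k) t), opp_IZR. apply Hm. lra. }
  assert (D0 : dot (gam m - p) (dg m) = 0).
  { destruct (rl_derive _ _ HL m) as [H1 H2].
    assert (Der : is_derive (fun t => (Re (gam t) - Re p) * (Re (gam t) - Re p) +
                      (Im (gam t) - Im p) * (Im (gam t) - Im p)) m (2 * dot (gam m - p) (dg m))).
    { set (F1 := fun t => Re (gam t)) in *. set (F2 := fun t => Im (gam t)) in *.
      change (is_derive (fun t => (F1 t - Re p) * (F1 t - Re p) + (F2 t - Im p) * (F2 t - Im p)) m
                (2 * ((F1 m - Re p) * Re (dg m) + (F2 m - Im p) * Im (dg m)))).
      assert (X1 : ex_derive F1 m) by (eexists; eassumption).
      assert (X2 : ex_derive F2 m) by (eexists; eassumption).
      apply is_derive_unique in H1. apply is_derive_unique in H2.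
      change (Derive (fun x => F1 x) m = Re (dg m)) in H1.
      change (Derive (fun x => F2 x) m = Im (dg m)) in H2.
      clearbody F1 F2. auto_derive; [tauto|]. rewrite H1, H2. ring. }
    apply is_derive_Reals in Der.
    set (pr := exist _ _ Der : derivable_pt _ m).
    assert (K := deriv_minimum _ (m - 1) (m + 1) m pr ltac:(lra) ltac:(lra)).
    simpl in K.
    assert (K' : 2 * dot (gam m - p) (dg m) = 0); [|lra].
    apply K. intros x _ _. specialize (Hg x).
    pose proof (Cmod_ge_0 (gam m - p)). pose proof (Cmod2_alt (gam m - p)).
    pose proof (Cmod2_alt (gam x - p)).
    assert (Cmod (gam m - p) ^ 2 <= Cmod (gam x - p) ^ 2) by nra.
    rewrite H0, H3 in H4. unfold Re, Im in *; simpl in *. lra. }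
  set (q := Cmod (dg m) ^ 2).
  assert (q0 : 0 < q) by (pose proof (Cmod_pos _ (rl_reg _ _ HL m)); unfold q; nra).
  exists m, (dot (p - gam m) (Ci * dg m) / q).
  assert (E : p = normal m (dot (p - gam m) (Ci * dg m) / q)).
  { unfold normal. unfold q in *. rewrite Cmod2_alt in *.
    destruct p as [p1 p2], (gam m) as [g1 g2], (dg m) as [d1 d2].
    unfold dot, Re, Im in *; simpl in *.
    set (w1 := p1 - g1). set (w2 := p2 - g2).
    assert (D : w1 * d1 + w2 * d2 = 0) by (unfold w1, w2; lra).
    set (al := _ / _). assert (Al : al = (w2 * d1 - w1 * d2) / (d1 * d1 + d2 * d2)).
    { unfold al, w1, w2. field. lra. }
    assert (A1 : w1 = al * (- d2)).
    { rewrite Al. transitivity (w1 - d1 * (w1 * d1 + w2 * d2) / (d1 * d1 + d2 * d2)); [|field; lra].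
      rewrite D. field. lra. }
    assert (A2 : w2 = al * d1).
    { rewrite Al. transitivity (w2 - d2 * (w1 * d1 + w2 * d2) / (d1 * d1 + d2 * d2)); [|field; lra].
      rewrite D. field. lra. }
    clearbody al. unfold Cplus, Cmult, RtoC; simpl.
    unfold w1 in A1. unfold w2 in A2. f_equal; lra. }
  set (a := dot (p - gam m) (Ci * dg m) / q) in *. clearbody a.
  assert (Ed : (p - gam m)%C = (a * (Ci * dg m))%C) by (rewrite E at 1; unfold normal; ring).
  split; [|split; [exact E|]].
  - intros ->. apply (Hp m). symmetry. rewrite E. unfold normal. ring.
  - intros u t' Iu Et. specialize (Hg t').
    assert (Pp : 0 < Cmod (gam m - p)).
    { apply Cmod_pos. intros Z. apply Cminus_eq_0 in Z. now apply (Hp m). }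
    (* A curve point on the open segment would be closer to p than the foot, by the factor 1 - u. *)
    assert (F : (gam t' - p)%C = (RtoC (1 - u) * (gam m - p))%C).
    { rewrite Et. replace (gam m - p)%C with (- (a * (Ci * dg m)))%C by (rewrite <- Ed; ring).
      rewrite E at 1. unfold normal. rewrite RtoC_minus, RtoC_mult. ring. }
    rewrite F, Cmod_mult, Cmod_R, Rabs_pos_eq in Hg by lra. nra.
Qed.

End Loop.

(** * The winding number of the tangent *)

Lemma clamp_lip (a b : R) : Rabs (clamp a - clamp b) <= Rabs (a - b).
Proof.
  unfold clamp, Rmax, Rmin. repeat destruct (Rle_dec _ _); unfold Rabs; repeat destruct (Rcase_abs _); lra.
Qed.

Lemma ccont_cont_on (c : R -> C) : (forall t, 0 <= t <= 1 -> ccont c t) -> cont_on_Rpt I01 c.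
Proof.
  intros Hc s Is eps He. destruct (proj1 (ccont_eps c s) (Hc s Is) eps He) as [d [d0 Hd]].
  exists d. split; [exact d0|]. intros t _ Ht. now apply Hd.
Qed.

(** The image under U of a contraction of c in D is a homotopy of loops that avoid 0. *)
Lemma simply_connected_winds (D : C -> Prop) (c : R -> C) (U : C -> C) :
  simply_connected2 D -> (forall t, 0 <= t <= 1 -> ccont c t) -> (forall t, 0 <= t <= 1 -> D (c t)) ->
  c 0 = c 1 -> (forall z, D z -> ccont U z /\ U z <> 0%C) -> winds (fun t => U (c t)) 0.
Proof.
  intros [_ SC] Hc HD E HU.
  destruct (SC c (ccont_cont_on c Hc) HD E) as [H [H1 [H2 [H3 [H4 H5]]]]].
  (* The contraction is run backwards, from the constant loop to c, and clamping extends it beyond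
     the square. *)
  set (h := fun z : C => (clamp (1 - fst z), clamp (snd z))).
  assert (hI : forall z, sq01 (h z)) by (intros z; split; apply clamp_I).
  assert (Hh : forall z : C, ccont (fun z => H (h z)) z).
  { intros z. apply ccont2_eps. intros eps He. destruct (H1 (h z) (hI z) eps He) as [d [d0 Hd]].
    exists d. split; [exact d0|]. intros q Hq. apply Hd; [apply hI|].
    apply dist2_lt in Hq. apply dist2_lt. unfold h; simpl.
    split; (eapply Rle_lt_trans; [apply clamp_lip|]); [|apply Hq].
    replace (1 - fst q - (1 - fst z)) with (- (fst q - fst z)) by ring. rewrite Rabs_Ropp. apply Hq. }
  assert (h1 : forall t, 0 <= t <= 1 -> H (h (1, t)) = c t).
  { intros t It. unfold h; simpl. rewrite Rminus_diag, !clamp_id by lra. now apply H3. }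
  apply (winds_ext (fun t => U (H (h (1, t))))).
  { intros t It. now rewrite h1. }
  apply (winds_homotopy (fun s t => U (H (h (s, t))))).
  - intros s t _ _. apply (ccont_comp (fun z : C => H (h (fst z, snd z))) U).
    + apply (ccont_comp (fun z : C => (fst z, snd z)) (fun z => H (h z))); [|apply Hh].
      apply ccont_pair; cont.
    + apply HU, H2, hI.
  - intros s t _ _. apply HU, H2, hI.
  - intros s _. exists 1. split; [lra|]. unfold h; simpl. rewrite !(clamp_id 0), !(clamp_id 1) by lra.
    rewrite (H5 _ (clamp_I _)). ring.
  - apply (winds_ext (fun _ => U (c 0))); [|apply winds_const].
    intros t It. unfold h; simpl. rewrite !clamp_id by lra. rewrite Rminus_0_r. now rewrite H4.
Qed.

(** * The two sides of the boundary curve *)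

Section Domain.
Variables (D : C -> Prop) (gam dg : R -> C).
Hypothesis HL : regular_loop gam dg.
Hypothesis Dclosed : closed2 D.
Hypothesis Dbounded : bounded2 D.
Hypothesis Dinterior : exists p, interior2 D p.
Hypothesis Dsimply : simply_connected2 D.
Hypothesis Dboundary : forall p, boundary2 D p <-> exists t, p = gam t.

Lemma dist2_refl (p : C) : dist2 p p = 0.
Proof. unfold dist2. rewrite !Rminus_diag, Rabs_R0. apply Rmax_left. lra. Qed.

Lemma subset_closure (p : C) : D p -> closure2 D p.
Proof. intros Hp eps He. exists p. split; [exact Hp|]. now rewrite dist2_refl. Qed.

Lemma gam_in (t : R) : D (gam t).
Proof. apply Dclosed. assert (B : boundary2 D (gam t)) by (apply Dboundary; eauto). apply B. Qed.

Lemma interior_off (p : C) : interior2 D p -> forall t, gam t <> p.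
Proof.
  intros Hi t E. assert (B : boundary2 D (gam t)) by (apply Dboundary; eauto).
  rewrite E in B. now apply B.
Qed.

Lemma off_interior (p : C) : D p -> (forall t, gam t <> p) -> interior2 D p.
Proof.
  intros Hp Ho. apply NNPP. intros N.
  assert (B : boundary2 D p) by (split; [now apply subset_closure|exact N]).
  apply Dboundary in B. destruct B as [t E]. now apply (Ho t).
Qed.

Lemma gam_exterior (p : C) : ~ D p -> exists e, 0 < e /\ forall q, dist2 q p < e -> ~ D q.
Proof.
  intros Hp. apply NNPP. intros N. apply Hp, Dclosed. intros eps He. apply NNPP. intros N'.
  apply N. exists eps. split; [exact He|]. intros q Hq Dq. apply N'. now exists q.
Qed.

(** Path components of the complement of the curve; membership in D and the winding number of the
    curve are invariants of this relation. *)
Definition linked (p q : C) : Prop := exists c : R -> C,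
  (forall s, 0 <= s <= 1 -> ccont c s) /\ (forall s, 0 <= s <= 1 -> forall t, gam t <> c s) /\
  c 0 = p /\ c 1 = q.

(** Off the curve both D and its complement are open, so the indicator of D along the path, scaled
    to the values 0 and 2 PI to suit [discrete_const], is continuous and hence constant. *)
Lemma linked_D (p q : C) : linked p q -> (D p <-> D q).
Proof.
  intros [c [Hc [Ho [<- <-]]]].
  set (d := fun t => if excluded_middle_informative (D (c (clamp t))) then 0 else 2 * PI).
  assert (E : d 0 = d 1).
  { apply discrete_const.
    - intros t. assert (It := clamp_I t).
      assert (Ct : ccont (fun t => c (clamp t)) t).
      { apply (ccont_Rcomp clamp); [apply (rcont_clamp (fun t => t)); cont|now apply Hc]. }
      assert (L : exists e, 0 < e /\ forall z, dist2 z (c (clamp t)) < e -> (D z <-> D (c (clamp t)))).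
      { destruct (classic (D (c (clamp t)))) as [Dt|Dt].
        - destruct (off_interior _ Dt (Ho _ It)) as [e [e0 He]]. exists e. split; [exact e0|].
          intros z Hz. specialize (He z Hz). tauto.
        - destruct (gam_exterior _ Dt) as [e [e0 He]]. exists e. split; [exact e0|].
          intros z Hz. specialize (He z Hz). tauto. }
      destruct L as [e [e0 He]]. destruct (proj1 (ccont_eps _ t) Ct e e0) as [dl [dl0 Hdl]].
      apply rcont_eps. intros eps Heps. exists dl. split; [exact dl0|]. intros y Hy.
      specialize (He _ (Hdl y Hy)). unfold d.
      destruct (excluded_middle_informative (D (c (clamp y)))),
        (excluded_middle_informative (D (c (clamp t)))); try tauto;
        rewrite Rminus_diag, Rabs_R0; exact Heps.
    - intros t _. unfold d. destruct (excluded_middle_informative _); [exists 0%Z|exists 1%Z]; ring. }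
  unfold d in E. rewrite !clamp_id in E by lra. pose proof PI_RGT_0.
  destruct (excluded_middle_informative (D (c 0))), (excluded_middle_informative (D (c 1))); try tauto; lra.
Qed.

Lemma linked_winds (p q : C) (k : Z) : linked p q ->
  winds (fun t => gam t - p)%C k -> winds (fun t => gam t - q)%C k.
Proof.
  intros [c [Hc [Ho [<- <-]]]]. apply (winds_homotopy (fun s t => (gam t - c s)%C)).
  - intros s t Is It. apply ccont_minus.
    + apply (ccont_Rcomp (fun z : C => snd z)); [cont|apply (rl_gamc _ _ HL)].
    + apply (ccont_Rcomp (fun z : C => fst z)); [cont|now apply Hc].
  - intros s t Is _ E. apply Cminus_eq_0 in E. now apply (Ho s Is t).
  - intros s _. exists 1. split; [lra|]. rewrite <- (rl_gamZ _ _ HL 1 0), Rplus_0_l. ring.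
Qed.

(** Foot and height are interpolated linearly; two heights of the same sign never pass through 0. *)
Lemma linked_collar (eta0 s s' eta eta' : R) :
  (forall s t eta, 0 < Rabs eta <= eta0 -> gam t <> normal gam dg s eta) ->
  0 < Rabs eta <= eta0 -> 0 < Rabs eta' <= eta0 -> 0 < eta * eta' ->
  linked (normal gam dg s eta) (normal gam dg s' eta').
Proof.
  intros HT H1 H2 H3.
  exists (fun u => normal gam dg ((1 - u) * s + u * s') ((1 - u) * eta + u * eta')).
  split; [|split; [|split]].
  - intros u _. apply (ccont_normal _ _ HL); cont.
  - intros u Iu t. apply HT.
    assert (Pos : forall x y, 0 < x <= eta0 -> 0 < y <= eta0 -> 0 < (1 - u) * x + u * y <= eta0).
    { intros x y Hx Hy. split; [|nra]. destruct (Rlt_dec u (/ 2)); nra. }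
    destruct (Rlt_dec 0 eta) as [L|L].
    + assert (0 < eta') by nra. rewrite Rabs_pos_eq in H1 by lra. rewrite Rabs_pos_eq in H2 by lra.
      specialize (Pos _ _ H1 H2). rewrite Rabs_pos_eq by lra. exact Pos.
    + assert (L1 : eta < 0) by (destruct (Req_dec eta 0) as [->|]; lra). assert (L2 : eta' < 0) by nra.
      rewrite Rabs_left in H1 by lra. rewrite Rabs_left in H2 by lra. specialize (Pos _ _ H1 H2).
      rewrite Rabs_left by lra. lra.
  - f_equal; ring.
  - f_equal; ring.
Qed.

(** Follow the shortest segment from p towards the curve until it enters the collar, then move along
    the collar to the base point of that side. Thus any invariant of [linked] takes at most two
    values. *)
Lemma linked_normal (eta0 : R) (p : C) (P : C -> Prop) : 0 < eta0 ->
  (forall s t eta, 0 < Rabs eta <= eta0 -> gam t <> normal gam dg s eta) ->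
  (forall p q, linked p q -> P p -> P q) -> (forall t, gam t <> p) -> P p ->
  P (normal gam dg 0 eta0) \/ P (normal gam dg 0 (- eta0)).
Proof.
  intros e0 HT HP Ho Pp. destruct (rl_nearest _ _ HL p Ho) as [t [a [Na [Ep Hn]]]].
  assert (Ap := Rabs_pos_lt a Na).
  (* The fraction of the normal segment whose height is at most eta0. *)
  set (u0 := Rmin 1 (eta0 / Rabs a)).
  assert (Iu : 0 < u0 <= 1).
  { split; [apply Rmin_pos; [lra|now apply Rdiv_lt_0_compat]|apply Rmin_l]. }
  assert (Hb : 0 < Rabs (u0 * a) <= eta0).
  { rewrite Rabs_mult, (Rabs_pos_eq u0) by lra. split; [nra|].
    assert (u0 <= eta0 / Rabs a) by apply Rmin_r.
    apply (Rmult_le_compat_r (Rabs a)) in H; [|lra].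
    replace (eta0 / Rabs a * Rabs a) with eta0 in H by (field; lra). exact H. }
  assert (P1 : P (normal gam dg t (u0 * a))).
  { apply (HP p); [|exact Pp].
    exists (fun s => normal gam dg t (((1 - s) + s * u0) * a)). split; [|split; [|split]].
    - intros s _. apply (ccont_normal _ _ HL); cont.
    - intros s Is t'. apply Hn. nra.
    - rewrite Ep. f_equal. ring.
    - f_equal. ring. }
  clearbody u0.
  assert (A1 : Rabs eta0 = eta0) by (apply Rabs_pos_eq; lra).
  destruct (Rlt_dec 0 a).
  - left. apply (HP (normal gam dg t (u0 * a))); [|exact P1].
    apply (linked_collar eta0); auto; [lra|]. apply Rmult_lt_0_compat; nra.
  - right. apply (HP (normal gam dg t (u0 * a))); [|exact P1].
    apply (linked_collar eta0); auto; [rewrite Rabs_Ropp; lra|].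
    assert (a < 0) by lra. assert (u0 * a < 0) by nra. nra.
Qed.

Lemma D_loop_winds (c : R -> C) (z : C) :
  (forall t, 0 <= t <= 1 -> ccont c t) -> (forall t, 0 <= t <= 1 -> D (c t)) -> c 0 = c 1 ->
  ~ D z -> winds (fun t => c t - z)%C 0.
Proof.
  intros Hc HD E Nz. apply (simply_connected_winds D c (fun y => (y - z)%C)); auto.
  intros y Dy. split; [cont|]. intros E0. apply Cminus_eq_0 in E0. now subst y.
Qed.

Lemma gam_01 : gam 0 = gam 1.
Proof. now rewrite <- (rl_gamZ _ _ HL 1 0), Rplus_0_l. Qed.

Lemma exterior_point : exists q, ~ D q.
Proof.
  destruct Dbounded as [M HM]. exists (M + 1, 0). intros Dq. destruct (HM _ Dq) as [H _]. simpl in H.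
  pose proof (Rle_abs (M + 1)). lra.
Qed.

(* Apply the torus lemma to gam t - q s, with q the curve pushed along the normal into D: the diagonal
   is a constant multiple of the tangent, and q does not wind about gam 0, because gam 0 is approached
   by points outside D. *)
Lemma tangent_winding_of_collar (eta : R) (e : Z) :
  eta <> 0 ->
  (forall s t eta', 0 < Rabs eta' <= Rabs eta -> gam t <> normal gam dg s eta') ->
  D (normal gam dg 0 eta) -> ~ D (normal gam dg 0 (- eta)) ->
  winds (fun t => gam t - normal gam dg 0 eta)%C e -> winds dg e.
Proof.
  intros N0 HT Din Dout We. assert (Ap := Rabs_pos_lt eta N0).
  assert (NZ : forall s, normal gam dg (s + 1) eta = normal gam dg s eta)
    by (intros s; apply (normal_period _ _ HL s eta 1)).
  assert (Nc : forall s, ccont (fun s => normal gam dg s eta) s)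
    by (intros s; apply (ccont_normal _ _ HL); cont).
  assert (N01 : normal gam dg 0 eta = normal gam dg 1 eta) by (now rewrite <- (NZ 0), Rplus_0_l).
  assert (HD : forall s, D (normal gam dg s eta)).
  { intros s. apply (linked_D (normal gam dg 0 eta)); [|exact Din].
    apply (linked_collar (Rabs eta)); auto; try lra. nra. }
  assert (HO : forall u, 0 < u <= 1 -> ~ D (normal gam dg 0 (- (u * eta)))).
  { intros u Iu K. apply Dout. revert K. apply linked_D.
    apply (linked_collar (Rabs eta)); auto; rewrite ?Rabs_Ropp, ?Rabs_mult, ?(Rabs_pos_eq u) by lra;
      try (split; nra). assert (0 < eta * eta) by nra. nra. }
  assert (W0 : winds (fun s => normal gam dg s eta - gam 0)%C 0).
  { apply (winds_ext (fun s => normal gam dg s eta - normal gam dg 0 (- ((1 - 1) * eta)))%C).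
    { intros s _. f_equal. f_equal. unfold normal. rewrite Rminus_diag, Rmult_0_l, Ropp_0. ring. }
    apply (winds_homotopy (fun u s => normal gam dg s eta - normal gam dg 0 (- ((1 - u) * eta)))%C).
    - intros u s _ _. apply ccont_minus.
      + apply (ccont_Rcomp (fun z : C => snd z)  (fun s => normal gam dg s eta)); [cont|apply Nc].
      + apply (ccont_normal _ _ HL); cont.
    - intros u s Iu _ E. apply Cminus_eq_0 in E. destruct (Req_dec u 1) as [->|Nu].
      + apply (HT s 0 eta); [lra|]. rewrite E. unfold normal. rewrite Rminus_diag, Rmult_0_l, Ropp_0. ring.
      + apply (HO (1 - u)); [lra|]. rewrite <- E. apply HD.
    - intros u _. exists 1. split; [lra|]. rewrite <- N01. ring.
    - apply (winds_ext (fun s => normal gam dg s eta - normal gam dg 0 (- eta))%C).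
      { intros s _. do 3 f_equal. ring. }
      apply (D_loop_winds (fun s => normal gam dg s eta)); auto. }
  assert (Wt : winds (fun t => gam t - normal gam dg t eta)%C (0 + e)).
  { apply (winds_torus (fun s t => gam t - normal gam dg s eta)%C).
    - intros s t _ _. apply ccont_minus.
      + apply (ccont_Rcomp (fun z : C => snd z)); [cont|apply (rl_gamc _ _ HL)].
      + apply (ccont_normal _ _ HL); cont.
    - intros s t _ _ E. apply Cminus_eq_0 in E. revert E. apply HT. lra.
    - intros s _. now rewrite gam_01.
    - intros t _. now rewrite N01.
    - apply (winds_ext (fun s => (- (1)) * (normal gam dg s eta - gam 0))%C); [intros; ring|].
      apply (winds_mult (fun _ => (- (1))%C) _ 0 0); [apply winds_const|exact W0].
    - exact We. }
  (* The diagonal is -eta i times the tangent, and the conjugate of that constant turns it into a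
     positive multiple of the tangent. *)
  assert (W := winds_mult _ _ _ _ (winds_const (Cconj (- (eta * Ci)))) Wt).
  simpl Z.add in W. revert W. apply winds_scale. intros t _.
  assert (0 < eta * eta) by nra. exists (/ (eta * eta)). split; [now apply Rinv_0_lt_compat|].
  replace (Cconj (- (eta * Ci)) * (gam t - normal gam dg t eta))%C
    with (RtoC (eta * eta) * dg t)%C.
  - rewrite Cmult_assoc, <- RtoC_mult, Rinv_l by lra. ring.
  - unfold normal. destruct (gam t), (dg t). unfold Cmult, Cconj, Cminus, Cplus, Copp, RtoC, Ci; simpl.
    f_equal; ring.
Qed.

(* The normal collar of the curve has two sides: the one linked to a far away point lies outside D,
   where the winding number vanishes, and crossing the curve changes it by one. *)
Lemma tangent_winding : exists e : Z, (e <> 0)%Z /\ winds dg e /\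
  forall p, interior2 D p -> winds (fun t => gam t - p)%C e.
Proof.
  destruct (rl_collar _ _ HL) as [eta0 [e0 [HT HJ]]].
  assert (A1 : Rabs eta0 = eta0) by (apply Rabs_pos_eq; lra).
  assert (A2 : Rabs (- eta0) = eta0) by (rewrite Rabs_Ropp; exact A1).
  assert (Gex : forall eta, Rabs eta = eta0 -> exists k, winds (fun t => gam t - normal gam dg 0 eta)%C k).
  { intros eta Ha. apply winds_exists.
    - intros t _. apply ccont_minus; [apply (rl_gamc _ _ HL)|apply ccont_const].
    - intros t _ E. apply Cminus_eq_0 in E. revert E. apply HT. lra.
    - exists 1. split; [lra|]. rewrite gam_01. ring. }
  destruct exterior_point as [q Nq].
  assert (Oq : forall t, gam t <> q) by (intros t E; apply Nq; rewrite <- E; apply gam_in).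
  assert (Wq : winds (fun t => gam t - q)%C 0).
  { apply D_loop_winds; auto; [intros; apply (rl_gamc _ _ HL)|intros; apply gam_in|apply gam_01]. }
  (* The sign of eta is chosen so that the exterior point q is linked to the side of -eta. *)
  assert (Side : exists eta, Rabs eta = eta0 /\ ~ D (normal gam dg 0 (- eta)) /\
            winds (fun t => gam t - normal gam dg 0 (- eta))%C 0).
  { destruct (linked_normal eta0 q (fun z => ~ D z /\ winds (fun t => gam t - z)%C 0) e0 HT) as [K|K]; auto.
    - intros y z L [H1 H2]. split; [|now apply (linked_winds y)].
      intros Dz. now apply H1, (linked_D y z L).
    - exists (- eta0). rewrite Ropp_involutive. auto.
    - exists eta0. auto. }
  destruct Side as [eta [Ha [Dout Wout]]].
  destruct (Gex eta Ha) as [e We].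
  assert (Nz : eta <> 0) by (intros ->; rewrite Rabs_R0 in Ha; lra).
  assert (Eeta : eta = eta0 \/ eta = - eta0) by (unfold Rabs in Ha; destruct (Rcase_abs eta); lra).
  (* An interior point is linked to a side contained in D, which can only be that of eta. *)
  assert (Inner : forall p, interior2 D p -> D (normal gam dg 0 eta) /\ winds (fun t => gam t - p)%C e).
  { intros p Hp. assert (Op := interior_off p Hp).
    assert (Dp : D p).
    { destruct Hp as [r [r0 Hr]]. apply Hr. now rewrite dist2_refl. }
    destruct (winds_exists (fun t => gam t - p)%C) as [k Wk].
    - intros t _. apply ccont_minus; [apply (rl_gamc _ _ HL)|apply ccont_const].
    - intros t _ E. apply Cminus_eq_0 in E. now apply (Op t).
    - exists 1. split; [lra|]. rewrite gam_01. ring.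
    - assert (K : D (normal gam dg 0 eta) /\ winds (fun t => gam t - normal gam dg 0 eta)%C k).
      { destruct (linked_normal eta0 p (fun z => D z /\ winds (fun t => gam t - z)%C k) e0 HT) as [K|K]; auto.
        - intros y z L [H1 H2]. split; [now apply (linked_D y)|now apply (linked_winds y)].
        - destruct Eeta as [-> | ->]; [exact K|]. rewrite Ropp_involutive in Dout. tauto.
        - destruct Eeta as [-> | ->]; [tauto|exact K]. }
      destruct K as [K1 K2]. split; [exact K1|].
      replace e with k; [exact Wk|]. apply (winds_unique (fun t => gam t - normal gam dg 0 eta)%C); auto.
      intros t _ E. apply Cminus_eq_0 in E. revert E. apply HT. lra. }
  exists e. split; [|split].
  - destruct Eeta as [-> | ->].
    + assert (X := HJ _ _ We Wout). lia.
    + rewrite Ropp_involutive in Wout. assert (X := HJ _ _ Wout We). lia.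
  - destruct Dinterior as [p Hp]. apply (tangent_winding_of_collar eta e); auto.
    + intros s t eta' He. apply HT. lra.
    + now apply (Inner p).
  - intros p Hp. now apply Inner.
Qed.

End Domain.

(** * Conformal points in the interior *)

Lemma cont2_continuous (h : R -> R -> R) (p : C) :
  cont2 h p -> continuous (fun z : C => h (fst z) (snd z)) p.
Proof.
  intros H. apply rcont2_eps. intros eps He. destruct (H eps He) as [d [d0 Hd]].
  exists d. split; [exact d0|]. intros q H1 H2. apply Hd. now apply dist2_lt.
Qed.

Lemma smooth2_continuous (h : R -> R -> R) (l : list bool) (p : C) :
  smooth2 h -> continuous (fun z : C => pder l h (fst z) (snd z)) p.
Proof. intros H. destruct p as [x y]. apply cont2_continuous. apply (H l x y). Qed.

Lemma Derive_mvt (u : R -> R) (a b : R) : (forall t, ex_derive u t) ->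
  exists c, Rmin a b <= c <= Rmax a b /\ u b - u a = Derive u c * (b - a).
Proof.
  intros H. apply (MVT_gen u a b (Derive u)).
  - intros x _. apply Derive_correct, H.
  - intros x _. apply continuity_pt_filterlim, @ex_derive_continuous, H.
Qed.

Lemma between_close (a b c p r : R) :
  Rmin a b <= c <= Rmax a b -> Rabs (a - p) < r -> Rabs (b - p) < r -> Rabs (c - p) < r.
Proof.
  intros H A B. apply Rabs_def2 in A. apply Rabs_def2 in B. apply Rabs_def1;
    unfold Rmin, Rmax in H; destruct (Rle_dec a b); lra.
Qed.

(** Strict differentiability: both points vary, which later makes w injective near p. The mean value
    theorem is applied to a horizontal and a vertical leg, which stay in the square where the
    partial derivatives are close to those at p. *)
Lemma smooth2_strict (h : R -> R -> R) (p : C) (eps : R) : smooth2 h -> 0 < eps ->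
  exists r, 0 < r /\ forall z z' : C, dist2 z p < r -> dist2 z' p < r ->
    Rabs (h (fst z) (snd z) - h (fst z') (snd z') -
          (dx h (fst p) (snd p) * (fst z - fst z') + dy h (fst p) (snd p) * (snd z - snd z')))
    <= eps * (Rabs (fst z - fst z') + Rabs (snd z - snd z')).
Proof.
  intros Hs He.
  destruct (proj1 (rcont2_eps _ p) (smooth2_continuous h (true :: nil) p Hs) eps He) as [r1 [p1 H1]].
  destruct (proj1 (rcont2_eps _ p) (smooth2_continuous h (false :: nil) p Hs) eps He) as [r2 [p2 H2]].
  simpl in H1, H2.
  exists (Rmin r1 r2). split; [now apply Rmin_pos|].
  intros [x y] [x' y'] Hz Hz'. apply dist2_lt in Hz. apply dist2_lt in Hz'. simpl in *.
  pose proof (Rmin_l r1 r2). pose proof (Rmin_r r1 r2).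
  destruct (Derive_mvt (fun t => h t y) x' x) as [c [Ic Ec]].
  { intros t. apply (Hs nil t y). }
  destruct (Derive_mvt (fun t => h x' t) y' y) as [d [Id Ed]].
  { intros t. apply (Hs nil x' t). }
  assert (C1 := between_close _ _ _ (fst p) r1 Ic ltac:(lra) ltac:(lra)).
  assert (C2 := between_close _ _ _ (snd p) r2 Id ltac:(lra) ltac:(lra)).
  assert (K1 := H1 (c, y) C1 ltac:(simpl; lra)). assert (K2 := H2 (x', d) ltac:(simpl; lra) C2).
  simpl in K1, K2.
  change (Derive (fun t => h t y) c) with (dx h c y) in Ec.
  change (Derive (fun t => h x' t) d) with (dy h x' d) in Ed.
  replace (h x y - h x' y' - (dx h (fst p) (snd p) * (x - x') + dy h (fst p) (snd p) * (y - y')))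
    with ((dx h c y - dx h (fst p) (snd p)) * (x - x') + (dy h x' d - dy h (fst p) (snd p)) * (y - y')).
  - eapply Rle_trans; [apply Rabs_triang|]. rewrite !Rabs_mult, Rmult_plus_distr_l.
    apply Rplus_le_compat; apply Rmult_le_compat_r; try apply Rabs_pos; lra.
  - replace (h x y - h x' y') with ((h x y - h x' y) + (h x' y - h x' y')) by ring.
    rewrite Ec, Ed. ring.
Qed.

Lemma smooth2_differentiable (h : R -> R -> R) (x y : R) : smooth2 h ->
  differentiable_pt_lim h x y (dx h x y) (dy h x y).
Proof.
  intros Hs eps. destruct (smooth2_strict h (x, y) (eps / 2) Hs) as [r [r0 Hr]].
  { pose proof (cond_pos eps). lra. }
  exists (mkposreal r r0). intros u v Hu Hv. simpl in Hu, Hv.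
  assert (K := Hr (u, v) (x, y)). simpl in K.
  eapply Rle_trans; [apply K|].
  - apply dist2_lt. now split.
  - now rewrite dist2_refl.
  - pose proof (Rmax_l (Rabs (u - x)) (Rabs (v - y))). pose proof (Rmax_r (Rabs (u - x)) (Rabs (v - y))).
    pose proof (cond_pos eps). nra.
Qed.

Lemma Cmod_le_sum (z : C) : Cmod z <= Rabs (Re z) + Rabs (Im z).
Proof.
  destruct z as [x y]. unfold Cmod; simpl.
  pose proof (Rabs_pos x). pose proof (Rabs_pos y).
  rewrite <- (sqrt_Rsqr (Rabs x + Rabs y)) by lra. apply sqrt_le_1_alt.
  assert (Rabs x * Rabs x = x * x) by (rewrite <- Rabs_mult; apply Rabs_pos_eq; nra).
  assert (Rabs y * Rabs y = y * y) by (rewrite <- Rabs_mult; apply Rabs_pos_eq; nra).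
  unfold Rsqr. nra.
Qed.

(* At a conformal point the differential of w is multiplication by a complex number,
   which moderation makes nonzero. *)
Lemma wcoord_strict (f g : R -> R -> R) (p : C) : smooth2 f -> smooth2 g ->
  moderate_at f g p -> conformal_point f g p ->
  exists (alpha : C) (r : R), alpha <> 0%C /\ 0 < r /\
    forall z z' : C, dist2 z p < r -> dist2 z' p < r ->
      Cmod (wcoord f g z - wcoord f g z' - alpha * (z - z')) <= Cmod alpha / 2 * Cmod (z - z').
Proof.
  intros Hf Hg Hm [Hc1 Hc2].
  set (a := dx f (fst p) (snd p)) in *. set (b := dx g (fst p) (snd p)) in *.
  (* At p, dF is multiplication by a + i b, and w is the mean of the identity and F. *)
  set (alpha := ((1 + a) / 2, b / 2) : C).
  assert (Na : alpha <> 0%C).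
  { intros E. injection E as E1 E2. apply Hm. fold a. rewrite <- Hc1. lra. }
  assert (A0 : 0 < Cmod alpha) by (now apply Cmod_pos).
  (* The two coordinates of w each contribute half of the error, and the sum of the absolute
     coordinates is at most twice the modulus, so |alpha| / 4 leads to |alpha| / 2. *)
  destruct (smooth2_strict f p (Cmod alpha / 4) Hf ltac:(lra)) as [r1 [p1 H1]].
  destruct (smooth2_strict g p (Cmod alpha / 4) Hg ltac:(lra)) as [r2 [p2 H2]].
  exists alpha, (Rmin r1 r2). split; [exact Na|]. split; [now apply Rmin_pos|].
  intros z z' Hz Hz'. pose proof (Rmin_l r1 r2). pose proof (Rmin_r r1 r2).
  assert (K1 := H1 z z' ltac:(lra) ltac:(lra)). assert (K2 := H2 z z' ltac:(lra) ltac:(lra)).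
  fold a in K1. fold b in K2. rewrite Hc2 in K1. rewrite <- Hc1 in K2.
  assert (S : Rabs (fst z - fst z') + Rabs (snd z - snd z') <= 2 * Cmod (z - z')).
  { pose proof (Rmax_Cmod (z - z')%C). simpl in H3.
    pose proof (Rmax_l (Rabs (fst z + - fst z')) (Rabs (snd z + - snd z'))).
    pose proof (Rmax_r (Rabs (fst z + - fst z')) (Rabs (snd z + - snd z'))). unfold Rminus. lra. }
  eapply Rle_trans; [apply Cmod_le_sum|].
  match goal with |- Rabs ?A + Rabs ?B <= _ =>
    replace A with ((f (fst z) (snd z) - f (fst z') (snd z') -
      (a * (fst z - fst z') + - b * (snd z - snd z'))) / 2)
      by (unfold wcoord, alpha, Re; simpl; field);
    replace B with ((g (fst z) (snd z) - g (fst z') (snd z') -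
      (b * (fst z - fst z') + a * (snd z - snd z'))) / 2)
      by (unfold wcoord, alpha, Im; simpl; field)
  end.
  unfold Rdiv at 1 2. rewrite !Rabs_mult, !(Rabs_pos_eq (/ 2)) by lra. nra.
Qed.

Lemma winds_winding (c : R -> C) (k : Z) : c 0 = c 1 -> (forall t, I01 t -> c t <> 0%C) ->
  winds c k -> winding c k.
Proof.
  intros E N [th [[L1 L2] K]]. split; [exact E|]. split; [exact N|].
  exists th. split; [|split; [|exact K]].
  - intros s _ eps He. destruct (proj1 (rcont_eps th s) (L1 s) eps He) as [d [d0 Hd]].
    exists d. split; [exact d0|]. intros t _ Ht. now apply Hd.
  - intros t It r. fold (Cmod (c t)) in r. rewrite (L2 t It) at 1. fold r.
    unfold Cmult, cis, RtoC; simpl. f_equal; ring.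
Qed.

(** * Comparison of small circles in the z-plane and in the w-plane *)

Section LocalIndex.
Variables (w V : C -> C) (p alpha : C) (rad : R) (k : Z).
Hypothesis Na : alpha <> 0%C.
Hypothesis rad0 : 0 < rad.
Hypothesis Hw : forall z z' : C, dist2 z p < rad -> dist2 z' p < rad ->
  Cmod (w z - w z' - alpha * (z - z')) <= Cmod alpha / 2 * Cmod (z - z').
Hypothesis Hwc : forall z, ccont w z.
Hypothesis HV : forall z, dist2 z p < rad -> z <> p -> ccont V z /\ V z <> 0%C.
Hypothesis Hk : index V p k.

Lemma Cmod_lt_dist2 (z : C) (r : R) : Cmod (z - p) < r -> dist2 z p < r.
Proof. intros H. eapply Rle_lt_trans; [apply dist2_Cmod|exact H]. Qed.

Lemma alpha_pos : 0 < Cmod alpha.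
Proof. now apply Cmod_pos. Qed.

(** Gives injectivity of w near p with a Lipschitz inverse, hence continuity of lifts. *)
Lemma w_expands (z z' : C) : dist2 z p < rad -> dist2 z' p < rad ->
  Cmod alpha * Cmod (z - z') <= 2 * Cmod (w z - w z').
Proof.
  intros Hz Hz'. assert (K := Hw z z' Hz Hz').
  assert (T := Cmod_triangle (w z - w z') (- (w z - w z' - alpha * (z - z')))).
  replace (w z - w z' + - (w z - w z' - alpha * (z - z')))%C with (alpha * (z - z'))%C in T by ring.
  rewrite Cmod_opp, Cmod_mult in T. lra.
Qed.

(* If v were omitted, the image of the circle of radius r would be contractible in the complement of v,
   whereas it winds once about v. *)
Lemma w_onto (r : R) (v : C) : 0 < r < rad -> Cmod (v - w p) <= Cmod alpha * r / 4 ->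
  exists z, Cmod (z - p) <= r /\ w z = v.
Proof.
  intros Hr Hv. pose proof alpha_pos as A0. apply NNPP. intros N.
  assert (M : forall s t : R, Cmod (p + s * (r * cis t) - p)%C = Rabs s * r).
  { intros s t. replace (p + s * (r * cis t) - p)%C with (s * (r * cis t))%C by ring.
    rewrite !Cmod_mult, !Cmod_R, Cmod_cis, (Rabs_pos_eq r); lra. }
  set (H := fun s t : R => (w (p + s * (r * cis (2 * PI * t))) - v)%C).
  assert (Hn : forall s t, 0 <= s <= 1 -> H s t <> 0%C).
  { intros s t Is E. apply Cminus_eq_0 in E. apply N. eexists. split; [|exact E].
    rewrite M, Rabs_pos_eq; nra. }
  assert (Hc : forall z : C, ccont (fun z : C => H (fst z) (snd z)) z).
  { intros z. apply ccont_minus; [|apply ccont_const].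
    apply (ccont_comp (fun z : C => (p + fst z * (r * cis (2 * PI * snd z)))%C) w); [cont|apply Hwc]. }
  assert (W1 : winds (H 1) 0).
  { apply (winds_homotopy H); auto.
    - intros s _. exists 1. split; [lra|]. unfold H.
      rewrite !Rmult_1_r, !Rmult_0_r, cis_1, cis_0. ring.
    - apply (winds_ext (fun _ => w p - v)%C); [|apply winds_const].
      intros t _. unfold H. do 2 f_equal. ring. }
  assert (W2 : winds (H 1) (0 + 1)).
  { apply (winds_leash (fun t => alpha * r * cis (2 * PI * t))%C).
    - intros t _. split; [cont|now apply ccont_slice].
    - rewrite Rmult_1_r, Rmult_0_r, cis_1, cis_0. ring.
    - unfold H. now rewrite Rmult_1_r, Rmult_0_r, cis_1, cis_0.
    - intros t _. unfold H. set (z := (p + 1%R * (r * cis (2 * PI * t)))%C).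
      assert (Mz : Cmod (z - p) = r) by (unfold z; rewrite M, Rabs_R1; ring).
      assert (Ez : (alpha * r * cis (2 * PI * t))%C = (alpha * (z - p))%C) by (unfold z; ring).
      rewrite Ez.
      assert (K := Hw z p ltac:(apply Cmod_lt_dist2; lra) ltac:(rewrite dist2_refl; lra)).
      (* The deviation is at most |alpha| r / 2 from the linearisation plus |alpha| r / 4 from v,
         less than |alpha| r. *)
      replace (alpha * (z - p) - (w z - v))%C
        with (- (w z - w p - alpha * (z - p)) + (v - w p))%C by ring.
      eapply Rle_lt_trans; [apply Cmod_triangle|]. rewrite Cmod_opp, Cmod_mult, Mz in *. nra.
    - apply (winds_mult (fun _ => alpha * r)%C); [apply winds_const|apply winds_cis]. }
  assert (E : (0 = 0 + 1)%Z).
  { apply (winds_unique (H 1)); auto. intros t _. apply Hn. lra. }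
  discriminate.
Qed.

(** [w_circle_lift] in complex notation. With rad / 4 in the sup distance the modulus stays below
    rad / 2, which leaves room in the disc for the homotopy to the linear model. *)
Definition small_circle_lift (r : R) (z : R -> C) : Prop :=
  cont_on_Rpt I01 z /\ z 0 = z 1 /\
  forall t, I01 t -> dist2 (z t) p < rad / 4 /\ w (z t) = (w p + r * cis (2 * PI * t))%C.

(** The lifted circle deviates from the model p + (r / alpha) cis by at most half of its distance to
    p. The segments between the two therefore avoid p, and V transports this homotopy. *)
Lemma small_circle_lift_winding (r : R) (z : R -> C) (rho : R) :
  (forall b : C, 0 < Cmod b < rho -> winds (fun t => V (p + b * cis (2 * PI * t))%C) k) ->
  0 < r < Cmod alpha * rho -> small_circle_lift r z -> winding (fun t => V (z t)) k.
Proof.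
  intros Hrho Hr [Z1 [Z2 Z3]]. pose proof alpha_pos as A0.
  assert (Zp : forall t, I01 t -> 0 < Cmod (z t - p) < rad / 2).
  { intros t It. destruct (Z3 t It) as [D1 D2]. split.
    - apply Cmod_pos. intros E. apply Cminus_eq_0 in E. rewrite E in D2.
      assert (F : (r * cis (2 * PI * t))%C = 0%C).
      { replace (r * cis (2 * PI * t))%C with (w p + r * cis (2 * PI * t) - w p)%C by ring.
        rewrite <- D2. ring. }
      apply (f_equal Cmod) in F. rewrite Cmod_mult, Cmod_R, Cmod_cis, Cmod_0, Rabs_pos_eq in F; lra.
    - eapply Rle_lt_trans; [apply Cmod_dist2|]. lra. }
  set (b := (r / alpha)%C).
  assert (Mb : Cmod b = r / Cmod alpha).
  { unfold b. rewrite Cmod_div, Cmod_R, Rabs_pos_eq; auto; lra. }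
  assert (Close : forall t, I01 t -> Cmod (b * cis (2 * PI * t) - (z t - p)) <= / 2 * Cmod (z t - p)).
  { intros t It. destruct (Z3 t It) as [D1 D2].
    assert (K := Hw (z t) p ltac:(lra) ltac:(rewrite dist2_refl; lra)). rewrite D2 in K.
    apply (Rmult_le_reg_l (Cmod alpha)); [exact A0|]. rewrite <- Cmod_mult.
    replace (alpha * (b * cis (2 * PI * t) - (z t - p)))%C
      with (w p + r * cis (2 * PI * t) - w p - alpha * (z t - p))%C by (unfold b; field; exact Na).
    lra. }
  apply winds_winding.
  - now rewrite Z2.
  - intros t It. destruct (Zp t It) as [E1 E2]. apply HV.
    + apply Cmod_lt_dist2. lra.
    + intros E. rewrite E in E1. replace (p - p)%C with (RtoC 0) in E1 by ring. rewrite Cmod_0 in E1. lra.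
  - set (h := fun s t => (p + ((1 - s)%R * (b * cis (2 * PI * t)) + s * (z (clamp t) - p)))%C).
    apply (winds_ext (fun t => V (h 1 t))).
    { intros t It. unfold h. rewrite clamp_id by exact It. f_equal.
      rewrite Rminus_diag. ring. }
    assert (Hh : forall s t, 0 <= s <= 1 -> 0 <= t <= 1 -> dist2 (h s t) p < rad /\ h s t <> p).
    { intros s t Is It. assert (Cl := Close t It). destruct (Zp t It) as [E1 E2].
      assert (Eh : (h s t - p)%C = ((z t - p) + (1 - s)%R * (b * cis (2 * PI * t) - (z t - p)))%C).
      { unfold h. rewrite clamp_id by exact It. rewrite RtoC_minus. ring. }
      assert (Small : Cmod ((1 - s)%R * (b * cis (2 * PI * t) - (z t - p))) <= / 2 * Cmod (z t - p)).
      { rewrite Cmod_mult, Cmod_R, Rabs_pos_eq by lra.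
        pose proof (Cmod_ge_0 (b * cis (2 * PI * t) - (z t - p))). nra. }
      split.
      - apply Cmod_lt_dist2. rewrite Eh. eapply Rle_lt_trans; [apply Cmod_triangle|]. lra.
      - intros E. assert (T := Cmod_triangle (h s t - p) (- ((1 - s)%R * (b * cis (2 * PI * t) - (z t - p))))).
        rewrite Eh in T at 1. rewrite E in T.
        replace (z t - p + (1 - s)%R * (b * cis (2 * PI * t) - (z t - p)) +
           - ((1 - s)%R * (b * cis (2 * PI * t) - (z t - p))))%C with (z t - p)%C in T by ring.
        replace (p - p)%C with (RtoC 0) in T by ring. rewrite Cmod_0, Cmod_opp in T. lra. }
    apply (winds_homotopy (fun s t => V (h s t))).
    + intros s t Is It. destruct (Hh s t Is It) as [H1 H2].
      apply (ccont_comp (fun z : C => h (fst z) (snd z)) V); [|now apply HV].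
      assert (Cz : ccont (fun t => z (clamp t)) t).
      { apply ccont_eps. intros eps He. destruct (Z1 (clamp t) (clamp_I t) eps He) as [d [d0 Hd]].
        exists d. split; [exact d0|]. intros y Hy. apply Hd; [apply clamp_I|].
        eapply Rle_lt_trans; [apply clamp_lip|exact Hy]. }
      assert (Cz' : ccont (fun x : C => z (clamp (snd x))) (s, t)).
      { apply (ccont_Rcomp (fun x : C => snd x) (fun t => z (clamp t))); [cont|exact Cz]. }
      unfold h. cont.
    + intros s t Is It. destruct (Hh s t Is It) as [H1 H2]. now apply HV.
    + intros s Is. exists 1. split; [lra|]. unfold h. rewrite !clamp_id, Z2 by lra.
      rewrite Rmult_1_r, Rmult_0_r, cis_1, cis_0. ring.
    + apply (winds_ext (fun t => V (p + b * cis (2 * PI * t))%C)).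
      { intros t _. unfold h. f_equal. rewrite Rminus_0_r. ring. }
      apply Hrho. rewrite Mb. split; [apply Rdiv_lt_0_compat; lra|].
      apply (Rmult_lt_reg_r (Cmod alpha)); [exact A0|]. unfold Rdiv.
      rewrite Rmult_assoc, Rinv_l by lra. lra.
Qed.

(** Preimages are chosen pointwise; [w_expands] makes the choice continuous. The constant 32 is 8
    times 4, from [w_onto] at radius rad / 8. *)
Lemma small_circle_lift_exists (r : R) : 0 < r <= Cmod alpha * rad / 32 ->
  exists z, small_circle_lift r z.
Proof.
  intros Hr. pose proof alpha_pos as A0.
  assert (K : forall v : C, exists z, Cmod (v - w p) <= Cmod alpha * rad / 32 ->
               Cmod (z - p) <= rad / 8 /\ w z = v).
  { intros v. destruct (Rle_lt_dec (Cmod (v - w p)) (Cmod alpha * rad / 32)) as [L|L].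
    - destruct (w_onto (rad / 8) v) as [z Hz]; [lra|lra|]. now exists z.
    (* An arbitrary value, for points too far from w p. *)
    - exists 0%C. lra. }
  destruct (choice _ K) as [pick Hp].
  assert (Hv : forall t, Cmod (w p + r * cis (2 * PI * t) - w p) <= Cmod alpha * rad / 32).
  { intros t. replace (w p + r * cis (2 * PI * t) - w p)%C with (r * cis (2 * PI * t))%C by ring.
    rewrite Cmod_mult, Cmod_R, Cmod_cis, Rabs_pos_eq; lra. }
  exists (fun t => pick (w p + r * cis (2 * PI * t))%C).
  assert (Pd : forall t, dist2 (pick (w p + r * cis (2 * PI * t))%C) p < rad / 4).
  { intros t. apply Cmod_lt_dist2. destruct (Hp _ (Hv t)). lra. }
  split; [|split].
  - intros s _ eps He.
    assert (Cv : ccont (fun t => w p + r * cis (2 * PI * t))%C s) by cont.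
    assert (E0 : 0 < Cmod alpha * eps / 4) by nra.
    destruct (proj1 (ccont_eps _ s) Cv _ E0) as [d [d0 Hd]].
    exists d. split; [exact d0|]. intros t _ Ht. specialize (Hd t Ht).
    eapply Rle_lt_trans; [apply dist2_Cmod|].
    assert (Q := w_expands (pick (w p + r * cis (2 * PI * t))%C) (pick (w p + r * cis (2 * PI * s))%C)
                   ltac:(specialize (Pd t); lra) ltac:(specialize (Pd s); lra)).
    rewrite (proj2 (Hp _ (Hv t))), (proj2 (Hp _ (Hv s))) in Q.
    assert (Q2 := Cmod_dist2 (w p + r * cis (2 * PI * t))%C (w p + r * cis (2 * PI * s))%C).
    apply (Rmult_lt_reg_l (Cmod alpha)); [exact A0|]. lra.
  - now rewrite Rmult_1_r, Rmult_0_r, cis_1, cis_0.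
  - intros t _. split; [apply Pd|]. apply (Hp _ (Hv t)).
Qed.

End LocalIndex.

Lemma ccont_wcoord (f g : R -> R -> R) (z : C) : smooth2 f -> smooth2 g -> ccont (wcoord f g) z.
Proof.
  intros Hf Hg. pose proof (smooth2_continuous f nil z Hf). pose proof (smooth2_continuous g nil z Hg).
  simpl in *. unfold wcoord, Rdiv. apply ccont_pair; cont.
Qed.

Lemma ccont_confV (f g : R -> R -> R) (z : C) : smooth2 f -> smooth2 g -> ccont (confV f g) z.
Proof.
  intros Hf Hg.
  pose proof (smooth2_continuous f (true :: nil) z Hf). pose proof (smooth2_continuous f (false :: nil) z Hf).
  pose proof (smooth2_continuous g (true :: nil) z Hg). pose proof (smooth2_continuous g (false :: nil) z Hg).
  simpl in *. unfold confV. apply ccont_pair; cont.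
Qed.

Lemma confV_eq_0 (f g : R -> R -> R) (p : C) : confV f g p = RtoC 0 <-> conformal_point f g p.
Proof.
  unfold conformal_point, confV. split.
  - intros E. injection E. lra.
  - intros [E1 E2]. unfold RtoC. f_equal; lra.
Qed.

Lemma index_conf_index (f g : R -> R -> R) (p : C) (d : R) (k : Z) : smooth2 f -> smooth2 g ->
  moderate_at f g p -> conformal_point f g p -> 0 < d ->
  (forall z, dist2 z p < d -> z <> p -> ~ conformal_point f g z) ->
  index (confV f g) p k -> conf_index f g p k.
Proof.
  intros Hf Hg Hm Hc d0 Hd Hk.
  destruct (wcoord_strict f g p Hf Hg Hm Hc) as [alpha [r [Na [r0 Hr]]]].
  assert (A0 : 0 < Cmod alpha) by (now apply Cmod_pos).
  set (rad := Rmin r d).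
  assert (Hrad : 0 < rad /\ rad <= r /\ rad <= d).
  { unfold rad. split; [now apply Rmin_pos|]. split; [apply Rmin_l|apply Rmin_r]. }
  clearbody rad. destruct Hrad as [rad0 [Hr1 Hr2]].
  assert (Hw : forall z z' : C, dist2 z p < rad -> dist2 z' p < rad ->
    Cmod (wcoord f g z - wcoord f g z' - alpha * (z - z')) <= Cmod alpha / 2 * Cmod (z - z')).
  { intros z z' H1 H2. apply Hr; lra. }
  assert (Hwc : forall z, ccont (wcoord f g) z) by (intros; now apply ccont_wcoord).
  assert (HV : forall z : C, dist2 z p < rad -> z <> p -> ccont (confV f g) z /\ confV f g z <> RtoC 0).
  { intros z H1 H2. split; [now apply ccont_confV|]. intros E. apply confV_eq_0 in E.
    revert E. apply Hd; [lra|exact H2]. }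
  destruct Hk as [rho [rho0 Hrho]].
  assert (Eq : forall s z, w_circle_lift f g p (rad / 4) s z <->
                           small_circle_lift (wcoord f g) p rad s z).
  { assert (E : forall s t, (fst (wcoord f g p) + s * cos (2 * PI * t), snd (wcoord f g p) + s * sin (2 * PI * t))
                     = (wcoord f g p + s * cis (2 * PI * t))%C).
    { intros s t. unfold Cplus, Cmult, cis, RtoC; simpl. f_equal; ring. }
    intros s z. split; intros [Z1 [Z2 Z3]]; (split; [exact Z1|]); (split; [exact Z2|]);
      intros t It; specialize (Z3 t It); [rewrite <- E|rewrite E]; exact Z3. }
  (* The first bound keeps the model circle within the radius where the index is read off; the
     second makes lifts exist. *)
  exists (rad / 4), (Rmin (Cmod alpha * rho) (Cmod alpha * rad / 32)).
  split; [lra|]. split; [apply Rmin_pos; nra|].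
  intros s Hs.
  pose proof (Rmin_l (Cmod alpha * rho) (Cmod alpha * rad / 32)).
  pose proof (Rmin_r (Cmod alpha * rho) (Cmod alpha * rad / 32)). split.
  - destruct (small_circle_lift_exists (wcoord f g) p alpha rad Na rad0 Hw Hwc s) as [z Hz]; [lra|].
    exists z. now apply Eq.
  - intros z Hz. apply Eq in Hz.
    apply (small_circle_lift_winding (wcoord f g) (confV f g) p alpha rad k Na rad0 Hw HV s z rho Hrho); auto.
    lra.
Qed.

(** * The field along the boundary *)

(** V times the squared conjugate of the tangent is purely imaginary and never 0. Its square is a
    negative real number, of winding number 0, whichever sign the imaginary part has. *)
Lemma confV_boundary (f g : R -> R -> R) (gam dg : R -> C) (e : Z) :
  regular_loop gam dg -> smooth2 f -> smooth2 g ->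
  (forall t, appF f g (gam t) = gam t) -> (forall t, jac f g (gam t) = 1) ->
  (forall t, ~ conformal_point f g (gam t)) ->
  winds dg e -> winds (fun t => confV f g (gam t)) (2 * e).
Proof.
  intros HL Hf Hg HF HJ Hn We.
  assert (Chain : forall h t, smooth2 h -> is_derive (fun s => h (Re (gam s)) (Im (gam s))) t
     (dx h (Re (gam t)) (Im (gam t)) * Re (dg t) + dy h (Re (gam t)) (Im (gam t)) * Im (dg t))).
  { intros h t Hh. destruct (rl_derive _ _ HL t) as [H1 H2]. apply is_derive_Reals.
    apply (derivable_pt_lim_comp_2d h (fun s => Re (gam s)) (fun s => Im (gam s))).
    - now apply smooth2_differentiable.
    - now apply is_derive_Reals.
    - now apply is_derive_Reals. }
  assert (Imag : forall t, Re (confV f g (gam t) * Cconj (dg t) ^ 2)%C = 0).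
  { intros t. destruct (rl_derive _ _ HL t) as [H1 H2].
    assert (F1 := Chain f t Hf). assert (F2 := Chain g t Hg).
    apply (is_derive_ext _ (fun s => Re (gam s))) in F1.
    2: { intros s. apply (f_equal Re (HF s)). }
    apply (is_derive_ext _ (fun s => Im (gam s))) in F2.
    2: { intros s. apply (f_equal Im (HF s)). }
    apply is_derive_unique in F1, F2, H1, H2.
    assert (E1 := eq_trans (eq_sym H1) F1). assert (E2 := eq_trans (eq_sym H2) F2). clear F1 F2 H1 H2.
    assert (J := HJ t). unfold jac in J.
    assert (N := rl_reg _ _ HL t). unfold confV.
    destruct (gam t) as [x y]. destruct (dg t) as [u v]. unfold Re, Im in *; simpl in *.
    set (fx := dx f x y) in *. set (fy := dy f x y) in *. set (gx := dx g x y) in *. set (gy := dy g x y) in *.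
    clearbody fx fy gx gy.
    (* F fixes the tangent vector and has determinant 1, so its trace is 2 *)
    assert (Tr : fx + gy = 2).
    { assert (D : 2 - fx - gy = (1 - fx) * (1 - gy) - fy * gx) by lra.
      assert (U1 : u - fx * u = fy * v) by lra. assert (V1 : v - gy * v = gx * u) by lra.
      assert (Tu : u * (2 - fx - gy) = 0).
      { rewrite D. transitivity ((u - fx * u) * (1 - gy) - u * fy * gx); [ring|].
        rewrite U1. transitivity (fy * (v - gy * v) - u * fy * gx); [ring|]. rewrite V1. ring. }
      assert (Tv : v * (2 - fx - gy) = 0).
      { rewrite D. transitivity ((v - gy * v) * (1 - fx) - v * fy * gx); [ring|].
        rewrite V1. transitivity (gx * (u - fx * u) - v * fy * gx); [ring|]. rewrite U1. ring. }
      destruct (Rmult_integral _ _ Tu); [|lra]. destruct (Rmult_integral _ _ Tv); [|lra].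
      exfalso. apply N. subst. reflexivity. }
    replace gy with (2 - fx) in * by lra.
    assert (P1 : u * (v * fy) = u * (u - fx * u)) by (f_equal; lra).
    assert (P2 : v * (u * gx) = v * (v - (2 - fx) * v)) by (f_equal; lra).
    transitivity ((2 * fx - 2) * (u * u - v * v) + 2 * (u * (v * fy)) + 2 * (v * (u * gx))); [ring|].
    rewrite P1, P2. ring. }
  set (V := (fun t => confV f g (gam t)) : R -> C).
  assert (Vn : forall t, V t <> 0%C).
  { intros t E. apply confV_eq_0 in E. now apply (Hn t). }
  assert (Vc : forall t, ccont V t).
  { intros t. apply (ccont_comp gam (confV f g)); [apply (rl_gamc _ _ HL)|now apply ccont_confV]. }
  destruct (winds_exists V) as [j Hj]; auto.
  { exists 1. split; [lra|]. assert (V1 : V 1 = V 0) by (unfold V; now rewrite (gam_01 _ _ HL)). rewrite V1. ring. }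
  assert (W := winds_pow _ _ 2 (winds_mult _ _ _ _ Hj (winds_pow _ _ 2 (winds_conj _ _ We)))).
  assert (Neg : winds (fun t => ((V t * Cconj (dg t) ^ 2) ^ 2)%C) 0).
  { apply (winds_scale (fun _ => (- (1))%C)); [|apply winds_const].
    intros t _. specialize (Imag t).
    assert (Nz : (V t * Cconj (dg t) ^ 2)%C <> 0%C).
    { apply Cmult_neq_0; [apply Vn|]. apply Cpow_nz, Cmod_gt_0. rewrite Cmod_conj.
      apply Cmod_gt_0, (rl_reg _ _ HL). }
    fold (V t) in Imag. set (L := (V t * Cconj (dg t) ^ 2)%C) in *. clearbody L.
    destruct L as [a b]. unfold Re in Imag. simpl in Imag. subst a.
    assert (Nb : b <> 0) by (intros ->; now apply Nz).
    exists (b * b). split; [now apply Rsqr_pos_lt|].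
    simpl. unfold Cmult, Copp, RtoC. simpl. f_equal; ring. }
  assert (Q : (2 * (j + 2 * - e) = 0)%Z).
  { apply (winds_unique (fun t => ((V t * Cconj (dg t) ^ 2) ^ 2)%C)); [|exact W|exact Neg].
    intros t _. apply Cpow_nz, Cmult_neq_0; [apply Vn|].
    apply Cpow_nz, Cmod_gt_0. rewrite Cmod_conj. apply Cmod_gt_0, (rl_reg _ _ HL). }
  replace (2 * e)%Z with j by lia. exact Hj.
Qed.

(** * Reduction of the theorem to the preceding parts *)

Lemma Derive_periodic (u : R -> R) (t : R) :
  (forall s, u (s + 1) = u s) -> Derive u (t + 1) = Derive u t.
Proof.
  intros Hp. unfold Derive. f_equal. apply Lim_ext. intros h.
  replace (t + 1 + h) with (t + h + 1) by ring. now rewrite !Hp.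
Qed.

Lemma smooth_regular_loop (gam : R -> pt) : smooth_simple_closed_curve gam ->
  regular_loop gam (fun t => (Derive (fun s => fst (gam s)) t, Derive (fun s => snd (gam s)) t)).
Proof.
  intros [S1 [S2 [Per [Inj Reg]]]]. split.
  - intros t. split; apply Derive_correct; [apply (S1 1%nat t)|apply (S2 1%nat t)].
  - intros t. apply ccont_pair; apply @ex_derive_continuous; [apply (S1 2%nat t)|apply (S2 2%nat t)].
  - intros t. split; [apply Per|].
    rewrite (Derive_periodic (fun s => fst (gam s))) by (intros; now rewrite Per).
    rewrite (Derive_periodic (fun s => snd (gam s))) by (intros; now rewrite Per). reflexivity.
  - exact Inj.
  - intros t E. injection E. intros. destruct (Reg t); contradiction.
Qed.

Lemma exists_NoDup_list {A : Type} (P : A -> Prop) (l : list A) :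
  (forall p, P p -> In p l) -> exists l', NoDup l' /\ forall p, P p <-> In p l'.
Proof.
  intros Hl.
  exists (filter (fun p => if excluded_middle_informative (P p) then true else false)
            (nodup (fun x y => excluded_middle_informative (x = y)) l)).
  split; [apply NoDup_filter, NoDup_nodup|]. intros p. rewrite filter_In, nodup_In.
  destruct (excluded_middle_informative (P p)) as [Hp|Hp].
  - split; auto.
  - split; [contradiction|]. intros [_ F]. discriminate.
Qed.

Lemma Forall2_choice {A B : Type} (P : A -> B -> Prop) (l : list A) :
  (forall a, In a l -> exists b, P a b) -> exists ks, Forall2 P l ks.
Proof.
  induction l as [|a l IH]; intros H; [now exists nil|].
  destruct (H a (or_introl eq_refl)) as [b Hb].
  destruct IH as [ks Hks]; [intros; apply H; now right|]. exists (b :: ks). now constructor.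
Qed.

Theorem theorem4 (D : pt -> Prop) (gam : R -> pt) (f g : R -> R -> R) :
  (* the domain D *)
  closed2 D -> bounded2 D ->
  (exists p, interior2 D p) ->
  connected2 D -> simply_connected2 D ->
  smooth_simple_closed_curve gam ->
  (forall p, boundary2 D p <-> exists t, p = gam t) ->
  (* F = (f, g) is a (smooth) symplectomorphism of D *)
  smooth2 f -> smooth2 g ->
  (forall p, D p -> D (appF f g p)) ->
  (exists f' g' : R -> R -> R, smooth2 f' /\ smooth2 g' /\
     (forall p, D p -> D (appF f' g' p)) /\
     (forall p, D p -> appF f' g' (appF f g p) = p) /\
     (forall p, D p -> appF f g (appF f' g' p) = p)) ->
  (forall p, D p -> jac f g p = 1) ->
  (* F is moderate *)
  (forall p, D p -> moderate_at f g p) ->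
  (* F is the identity on gamma, with no conformal points there *)
  (forall t, appF f g (gam t) = gam t) ->
  (forall t, ~ conformal_point f g (gam t)) ->
  (* conclusion: at least two conformal points in the interior, with multiplicity *)
  (~ exists l : list pt, forall p, interior2 D p -> conformal_point f g p -> In p l) \/
  (exists (l : list pt) (ks : list Z),
     NoDup l /\
     (forall p, (interior2 D p /\ conformal_point f g p) <-> In p l) /\
     Forall2 (conf_index f g) l ks /\
     (sumZ ks >= 2)%Z).
Proof.
  intros Dc Db Di _ Ds Hgam Dbd Hf Hg _ _ HJ Hm HF Hn.
  (* Infinitely many conformal points give the first alternative. If there are finitely many, each
     of them is isolated and has an index. *)
  destruct (classic (exists l : list pt, forall p, interior2 D p -> conformal_point f g p -> In p l))
    as [[l0 Hl0]|N]; [right|now left].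
  assert (HL := smooth_regular_loop gam Hgam).
  set (dg := fun t => (Derive (fun s => fst (gam s)) t, Derive (fun s => snd (gam s)) t) : C) in HL.
  clearbody dg.
  destruct (exists_NoDup_list (fun p => interior2 D p /\ conformal_point f g p) l0) as [l [ND Hl]].
  { intros p []. auto. }
  destruct (tangent_winding D gam dg HL Dc Db Di Ds Dbd) as [e [Ne [We Wp]]].
  assert (Gin : forall t, D (gam t)) by (intros; now apply (gam_in D gam)).
  assert (Conf : forall z, D z -> conformal_point f g z -> In z l).
  { intros z Dz Cz. apply Hl. split; [|exact Cz].
    apply (off_interior D gam Dbd z Dz). intros t E. rewrite <- E in Cz. now apply (Hn t). }
  destruct (Forall2_choice (fun p k => index (confV f g) p k /\ conf_index f g p k) l) as [ks Hks].
  { intros p Hp. destruct (proj2 (Hl p) Hp) as [Ip Cp].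
    assert (Ip' := Ip). destruct Ip' as [d1 [d10 Hd1]].
    destruct (finite_ball p (remove (fun x y => excluded_middle_informative (x = y)) p l)) as [d2 [d20 Hd2]].
    { apply remove_In. }
    (* The half makes up for the factor 2 between modulus and sup distance. *)
    set (d := Rmin d1 (d2 / 2)).
    assert (d0 : 0 < d) by (apply Rmin_pos; lra).
    assert (Iso : forall z, dist2 z p < d -> z <> p -> ~ conformal_point f g z).
    { intros z Hz Nz Cz. pose proof (Rmin_l d1 (d2 / 2)). pose proof (Rmin_r d1 (d2 / 2)).
      assert (Iz : In z l) by (apply Conf; [apply Hd1; unfold d in Hz; lra|exact Cz]).
      assert (K := Hd2 z (in_in_remove _ _ Nz Iz)). pose proof (Cmod_dist2 z p).
      unfold d in Hz. lra. }
    destruct (index_exists (confV f g) p d d0) as [k Hk].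
    { intros z [Z0 Z1]. split; [now apply ccont_confV|]. intros E. apply confV_eq_0 in E.
      revert E. apply Iso.
      - eapply Rle_lt_trans; [apply dist2_Cmod|exact Z1].
      - intros ->. replace (p - p)%C with (RtoC 0) in Z0.
        + rewrite Cmod_0 in Z0. lra.
        + destruct p. unfold Cminus, Cplus, Copp, RtoC; simpl. f_equal; ring. }
    exists k. split; [exact Hk|]. apply (index_conf_index f g p d k); auto.
    apply Hm, Hd1. rewrite dist2_refl. exact d10. }
  exists l, ks. split; [exact ND|]. split; [exact Hl|].
  assert (W1 : winds (fun t => confV f g (gam t)) (e * sumZ ks)).
  { apply (index_sum D gam e) with (S := l).
    - intros t _. apply (rl_gamc _ _ HL).
    - intros t _. apply Gin.
    - intros U HU. apply (simply_connected_winds D gam U Ds); auto.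
      + intros t _. apply (rl_gamc _ _ HL).
      + apply (gam_01 _ _ HL).
    - exact ND.
    - intros p Hp t _. apply (interior_off D gam Dbd). now apply Hl.
    - intros p Hp. apply Wp. now apply Hl.
    - intros p Hp. now apply Hl.
    - intros z Dz Nz. split; [now apply ccont_confV|]. intros E. apply confV_eq_0 in E.
      now apply Nz, Conf.
    - clear - Hks. induction Hks as [|p k l ks []]; constructor; assumption. }
  assert (W2 := confV_boundary f g gam dg e HL Hf Hg HF (fun t => HJ _ (Gin t)) Hn We).
  split.
  - clear - Hks. induction Hks as [|p k l ks []]; constructor; assumption.
  (* The winding number of V along the curve, computed once from the zeros and once from the
     tangent; cancelling e gives exactly 2. *)
  - assert (E : (e * sumZ ks = 2 * e)%Z).
    { apply (winds_unique (fun t => confV f g (gam t))); [|exact W1|exact W2].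
      intros t _ E. apply confV_eq_0 in E. now apply (Hn t). }
    assert (sumZ ks = 2)%Z by nia. lia.
Qed.
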